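(* Let $(\mathscr{C}, S)$ be a suspended additive category, and $\eta \colon 1_{\mathscr{C}} \to S$ a natural transformation with the property that $\eta_{SM} = S\eta_M$ for every object $M$ of $\mathscr{C}$. Let $d \ge 2$ be an even integer, let $\mathbf{HFact}_d(\mathscr{C},S,\eta)$ be the homotopy category of $d$-fold $(\mathscr{C},S)$-factorizations of $\eta$, and let $\Sigma \colon \mathbf{HFact}_d(\mathscr{C},S,\eta) \to \mathbf{HFact}_d(\mathscr{C},S,\eta)$ be its suspension. Finally, let $\Delta$ be the collection of all triangles in $\mathbf{HFact}_d(\mathscr{C},S,\eta)$ isomorphic to a standard triangle. Then $$\left( \mathbf{HFact}_d(\mathscr{C},S,\eta), \Sigma, \Delta \right)$$ is an algebraic triangulated category.
   Context: A suspended additive category $(\mathscr{C},S)$ is an additive category $\mathscr{C}$ together with an additive automorphism $S \colon \mathscr{C} \to \mathscr{C}$. Factorizations. A $d$-fold $(\mathscr{C},S)$-factorization $(M_i,f_i)$ of $\eta$ is a sequence $M_1 \xrightarrow{f_1} M_2 \xrightarrow{f_2} \cdots \xrightarrow{f_{d-1}} M_d \xrightarrow{f_d} SM_1$ of $d$ morphisms in $\mathscr{C}$ in which every $d$-fold composition equals $\eta$: $f_d \circ \cdots \circ f_1 = \eta_{M_1}$, $Sf_1 \circ f_d \circ \cdots \circ f_2 = \eta_{M_2}$, ..., $Sf_{d-1} \circ \cdots \circ Sf_1 \circ f_d = \eta_{M_d}$. A morphism $\varphi \colon (M_i,f_i) \to (N_i,g_i)$ is a sequence $(\varphi_1,\dots,\varphi_d)$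 of morphisms $\varphi_i \colon M_i \to N_i$ in $\mathscr{C}$ with $\varphi_{i+1} \circ f_i = g_i \circ \varphi_i$ for $1 \le i \le d-1$ and $S\varphi_1 \circ f_d = g_d \circ \varphi_d$. This gives an additive category $\mathbf{Fact}_d(\mathscr{C},S,\eta)$ (addition and coproducts are componentwise). Homotopies. Two morphisms $\varphi,\varphi' \colon (M_i,f_i) \to (N_i,g_i)$ are homotopic if there exist morphisms $s_i \colon M_{i+1} \to N_i$ ($1 \le i \le d-1$) and $s_d \colon SM_1 \to N_d$ in $\mathscr{C}$ such that $\varphi_1 - \varphi_1' = s_1 \circ f_1 + S^{-1}g_d \circ S^{-1}s_d$ and $\varphi_i - \varphi_i' = s_i \circ f_i + g_{i-1} \circ s_{i-1}$ for $2 \le i \le d$. This is an equivalence relation compatible with addition and composition; $[\varphi]$ denotes the class of $\varphi$. The homotopy category $\mathbf{HFact}_d(\mathscr{C},S,\eta)$ has the same objects as $\mathbf{Fact}_d(\mathscr{C},S,\eta)$, and its morphisms are the homotopy classes of morphisms. Suspension. $\Sigma(M_i,f_i)$ is the factorization $M_2 \xrightarrow{-f_2} M_3 \xrightarrow{-f_3} \cdots \xrightarrow{-f_{d-1}} M_d \xrightarrow{-f_d} SM_1 \xrightarrow{-Sf_1} SM_2$, and $\Sigma(\varphi_1,\dots,\varphi_d) = (\varphi_2,\dots,\varphi_d,S\varphi_1)$. This induces an additive automorphism $\Sigma$ of $\mathbf{HFact}_d(\mathscr{C},S,\eta)$. Mapping cones. For a morphism $\varphi \colon (M_i,f_i) \to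 (N_i,g_i)$ in $\mathbf{Fact}_d(\mathscr{C},S,\eta)$, the mapping cone $C_\varphi$ is the factorization $$M_2 \oplus N_1 \to M_3 \oplus N_2 \to \cdots \to SM_1 \oplus N_d \to SM_2 \oplus SN_1$$ whose $i$-th map is $\left[\begin{smallmatrix} -f_{i+1} & 0 \\ \varphi_{i+1} & g_i \end{smallmatrix}\right]$ for $1 \le i \le d-1$ and whose $d$-th map is $\left[\begin{smallmatrix} -Sf_1 & 0 \\ S\varphi_1 & g_d \end{smallmatrix}\right]$. There are morphisms $i_\varphi \colon (N_i,g_i) \to C_\varphi$ and $\pi_\varphi \colon C_\varphi \to \Sigma(M_i,f_i)$ in $\mathbf{Fact}_d(\mathscr{C},S,\eta)$ whose components are all $\left[\begin{smallmatrix} 0 \\ 1 \end{smallmatrix}\right]$ and $\left[\begin{smallmatrix} 1 & 0 \end{smallmatrix}\right]$, respectively. Triangles. A triangle in $\mathbf{HFact}_d(\mathscr{C},S,\eta)$ is a sequence $X \to Y \to Z \to \Sigma X$ of objects and morphisms; morphisms and isomorphisms of triangles are defined as usual. A standard triangle is one of the form $(M_i,f_i) \xrightarrow{[\varphi]} (N_i,g_i) \xrightarrow{[i_\varphi]} C_\varphi \xrightarrow{[\pi_\varphi]} \Sigma(M_i,f_i)$ for a morphism $\varphi$ in $\mathbf{Fact}_d(\mathscr{C},S,\eta)$. Algebraic. A triangulated category is algebraic if, up to equivalence of triangulated categories, it can be characterized in one of the following equivalent ways: (1) as the stable category of some Frobenius exact category; (2) as a full triangulated subcategory of the homotopy category of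 (complexes over) some additive category; (3) as the zeroth cohomology category of some pretriangulated differential graded category. *)

(* Defs.v *)
From HB Require Import structures.
From mathcomp Require Import all_boot all_algebra.
From mathcomp Require Import boolp.

Set Implicit Arguments.
Unset Strict Implicit.
Unset Printing Implicit Defensive.

Import GRing.Theory.
Local Open Scope ring_scope.

Declare Scope cat_scope.
Local Open Scope cat_scope.

Record preaddCat := PreaddCat {
  ob :> Type;
  hom : ob -> ob -> zmodType;
  idm : forall X, hom X X;
  cmp : forall X Y Z, hom Y Z -> hom X Y -> hom X Z;
  cmpA : forall X Y Z W (h : hom Z W) (g : hom Y Z) (f : hom X Y),
    cmp h (cmp g f) = cmp (cmp h g) f;
  cmp1m : forall X Y (f : hom X Y), cmp (idm Y) f = f;
  cmpm1 : forall X Y (f : hom X Y), cmp f (idm X) = f;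
  cmpDl : forall X Y Z (g g' : hom Y Z) (f : hom X Y),
    cmp (g + g') f = cmp g f + cmp g' f;
  cmpDr : forall X Y Z (g : hom Y Z) (f f' : hom X Y),
    cmp g (f + f') = cmp g f + cmp g f' }.

Arguments hom {p} X Y.
Arguments idm {p} X.
Arguments cmp {p X Y Z} g f.

Notation "g \oc f" := (cmp g f) (at level 40, left associativity) : cat_scope.

(* A zero object and binary biproducts are chosen. *)
Record addCat := AddCat {
  addCat_cat :> preaddCat;
  zob : addCat_cat;
  bip : addCat_cat -> addCat_cat -> addCat_cat;
  in1 : forall X Y, hom X (bip X Y);
  in2 : forall X Y, hom Y (bip X Y);
  pr1 : forall X Y, hom (bip X Y) X;
  pr2 : forall X Y, hom (bip X Y) Y;
  zobP : idm zob = 0;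
  pr1in1 : forall X Y, pr1 X Y \oc in1 X Y = idm X;
  pr2in2 : forall X Y, pr2 X Y \oc in2 X Y = idm Y;
  pr1in2 : forall X Y, pr1 X Y \oc in2 X Y = 0;
  pr2in1 : forall X Y, pr2 X Y \oc in1 X Y = 0;
  bipE : forall X Y,
    in1 X Y \oc pr1 X Y + in2 X Y \oc pr2 X Y = idm (bip X Y) }.

Arguments zob {a}.
Arguments bip {a} X Y.
Arguments in1 {a} X Y.
Arguments in2 {a} X Y.
Arguments pr1 {a} X Y.
Arguments pr2 {a} X Y.

Record addFun (C D : preaddCat) := AddFun {
  fob :> C -> D;
  fmor : forall X Y, hom X Y -> hom (fob X) (fob Y);
  fmor1 : forall X, fmor (idm X) = idm (fob X);
  fmorM : forall X Y Z (g : hom Y Z) (f : hom X Y),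
    fmor (g \oc f) = fmor g \oc fmor f;
  fmorD : forall X Y (f f' : hom X Y), fmor (f + f') = fmor f + fmor f' }.

Arguments fmor {C D} a {X Y} f.

Section PreaddTheory.
Variable C : preaddCat.
Implicit Types X Y Z : C.

Lemma cmp0m X Y Z (f : hom X Y) : (0 : hom Y Z) \oc f = 0.
Proof. by apply: (@addrI _ (0 \oc f)); rewrite -cmpDl !addr0. Qed.

Lemma cmpm0 X Y Z (g : hom Y Z) : g \oc (0 : hom X Y) = 0.
Proof. by apply: (@addrI _ (g \oc 0)); rewrite -cmpDr !addr0. Qed.

Lemma cmpNm X Y Z (g : hom Y Z) (f : hom X Y) : (- g) \oc f = - (g \oc f).
Proof. by apply: (@addrI _ (g \oc f)); rewrite -cmpDl !subrr cmp0m. Qed.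

Lemma cmpmN X Y Z (g : hom Y Z) (f : hom X Y) : g \oc (- f) = - (g \oc f).
Proof. by apply: (@addrI _ (g \oc f)); rewrite -cmpDr !subrr cmpm0. Qed.

Lemma cmpBl X Y Z (g g' : hom Y Z) (f : hom X Y) :
  (g - g') \oc f = g \oc f - g' \oc f.
Proof. by rewrite cmpDl cmpNm. Qed.

Lemma cmpBr X Y Z (g : hom Y Z) (f f' : hom X Y) :
  g \oc (f - f') = g \oc f - g \oc f'.
Proof. by rewrite cmpDr cmpmN. Qed.

End PreaddTheory.

Section FunctorTheory.
Variables (C D : preaddCat) (F : addFun C D).

Lemma fmor0 X Y : fmor F (0 : hom X Y) = 0.
Proof. by apply: (@addrI _ (fmor F 0)); rewrite -fmorD !addr0. Qed.

Lemma fmorN X Y (f : hom X Y) : fmor F (- f) = - fmor F f.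
Proof. by apply: (@addrI _ (fmor F f)); rewrite -fmorD !subrr fmor0. Qed.

Lemma fmorB X Y (f f' : hom X Y) : fmor F (f - f') = fmor F f - fmor F f'.
Proof. by rewrite fmorD fmorN. Qed.

End FunctorTheory.

Definition idFun (C : preaddCat) : addFun C C :=
  @AddFun C C (fun X => X) (fun _ _ f => f)
    (fun _ => erefl) (fun _ _ _ _ _ => erefl) (fun _ _ _ _ => erefl).

Definition is_iso (C : preaddCat) (X Y : C) (f : hom X Y) : Prop :=
  exists g : hom Y X, g \oc f = idm X /\ f \oc g = idm Y.

Definition fully_faithful (C D : preaddCat) (F : addFun C D) : Prop :=
  forall X Y, bijective (@fmor C D F X Y).

Definition ess_surjective (C D : preaddCat) (F : addFun C D) : Prop :=
  forall Y : D, exists (X : C) (f : hom (F X) Y), is_iso f.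

(* Isomorphisms of categories, in the form that avoids equalities of functors;
   [F^-1] acts on [hom (F X) (F Y)] as [fmor_inv] below. *)
Definition is_automorphism (C : preaddCat) (F : addFun C C) : Prop :=
  bijective (fob F) /\ fully_faithful F.

Lemma fmor_surj (C D : preaddCat) (F : addFun C D) (Fff : fully_faithful F)
  X Y (h : hom (F X) (F Y)) : exists f : hom X Y, fmor F f = h.
Proof. by case: (Fff X Y) => g _ gK; exists (g h). Qed.

Definition fmor_inv (C D : preaddCat) (F : addFun C D) (Fff : fully_faithful F)
  X Y (h : hom (F X) (F Y)) : hom X Y := sval (cid (fmor_surj Fff h)).

Lemma fmor_invK (C D : preaddCat) (F : addFun C D) (Fff : fully_faithful F)
  X Y (h : hom (F X) (F Y)) : fmor F (fmor_inv Fff h) = h.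
Proof. by rewrite /fmor_inv; case: cid. Qed.

Lemma fmor_inj (C D : preaddCat) (F : addFun C D) (Fff : fully_faithful F)
  X Y (f f' : hom X Y) : fmor F f = fmor F f' -> f = f'.
Proof. exact: (bij_inj (Fff X Y)). Qed.

Lemma fmorK (C D : preaddCat) (F : addFun C D) (Fff : fully_faithful F)
  X Y (f : hom X Y) : fmor_inv Fff (fmor F f) = f.
Proof. by apply: (fmor_inj Fff); rewrite fmor_invK. Qed.

Record ideal (C : preaddCat) := Ideal {
  idl :> forall X Y : C, hom X Y -> Prop;
  idl0 : forall X Y, idl (0 : hom X Y);
  idlB : forall X Y (f g : hom X Y), idl f -> idl g -> idl (f - g);
  idlL : forall X Y Z (g : hom Y Z) (f : hom X Y), idl f -> idl (g \oc f);
  idlR : forall X Y Z (g : hom Y Z) (f : hom X Y), idl g -> idl (g \oc f) }.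

Arguments idl {C} i {X Y} f.

Definition idlp (C : preaddCat) (J : ideal C) (X Y : C) : {pred hom X Y} :=
  fun f => `[< idl J f >].

Fact idlp_closed (C : preaddCat) (J : ideal C) (X Y : C) :
  zmod_closed (@idlp C J X Y).
Proof.
split; first by apply/asboolP; exact: idl0.
by move=> f g /asboolP Jf /asboolP Jg; apply/asboolP; exact: idlB.
Qed.

HB.instance Definition _ (C : preaddCat) (J : ideal C) (X Y : C) :=
  GRing.isZmodClosed.Build (hom X Y) (@idlp C J X Y) (idlp_closed J X Y).

Section QuotCat.
Variables (C : preaddCat) (J : ideal C).

Definition qhom (X Y : C) : zmodType := Quotient.quot (@idlp C J X Y).

Definition qcls X Y (f : hom X Y) : qhom X Y := (\pi_(qhom X Y) f)%qT.

Lemma qclsP X Y (f g : hom X Y) : qcls f = qcls g <-> idl J (f - g).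
Proof.
rewrite /qcls; split=> [/eqP|Jfg].
  by rewrite -Quotient.idealrBE => /asboolP.
by apply/eqP; rewrite -Quotient.idealrBE; exact/asboolP.
Qed.

Lemma qclsD X Y (f g : hom X Y) : qcls (f + g) = qcls f + qcls g.
Proof. exact: raddfD. Qed.

Lemma qcls0 X Y : qcls (0 : hom X Y) = 0.
Proof. exact: raddf0. Qed.

Lemma qclsK X Y (u : qhom X Y) : qcls (repr u) = u.
Proof. exact: reprK. Qed.

Definition qcmp X Y Z (v : qhom Y Z) (u : qhom X Y) : qhom X Z :=
  qcls (repr v \oc repr u).

Lemma qclsM X Y Z (g : hom Y Z) (f : hom X Y) :
  qcmp (qcls g) (qcls f) = qcls (g \oc f).
Proof.
apply/qclsP; set g' := repr _; set f' := repr _.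
have Jg : idl J (g' - g) by apply/qclsP; rewrite qclsK.
have Jf : idl J (f' - f) by apply/qclsP; rewrite qclsK.
rewrite (_ : _ - _ = (g' - g) \oc f' - g \oc (f - f')); last first.
  by rewrite cmpBl cmpBr opprB addrA subrK.
apply: idlB; first exact: idlR.
by apply: idlL; rewrite -opprB -sub0r; apply: idlB => //; exact: idl0.
Qed.

Fact qcmpA X Y Z W (h : qhom Z W) (g : qhom Y Z) (f : qhom X Y) :
  qcmp h (qcmp g f) = qcmp (qcmp h g) f.
Proof. by rewrite -(qclsK h) -(qclsK g) -(qclsK f) !qclsM cmpA. Qed.

Fact qcmp1m X Y (f : qhom X Y) : qcmp (qcls (idm Y)) f = f.
Proof. by rewrite -(qclsK f) qclsM cmp1m. Qed.

Fact qcmpm1 X Y (f : qhom X Y) : qcmp f (qcls (idm X)) = f.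
Proof. by rewrite -(qclsK f) qclsM cmpm1. Qed.

Fact qcmpDl X Y Z (g g' : qhom Y Z) (f : qhom X Y) :
  qcmp (g + g') f = qcmp g f + qcmp g' f.
Proof.
by rewrite -(qclsK g) -(qclsK g') -(qclsK f) -qclsD !qclsM cmpDl qclsD.
Qed.

Fact qcmpDr X Y Z (g : qhom Y Z) (f f' : qhom X Y) :
  qcmp g (f + f') = qcmp g f + qcmp g f'.
Proof.
by rewrite -(qclsK g) -(qclsK f) -(qclsK f') -qclsD !qclsM cmpDr qclsD.
Qed.

Definition quot_preadd : preaddCat :=
  @PreaddCat C qhom (fun X => qcls (idm X)) qcmp
    qcmpA qcmp1m qcmpm1 qcmpDl qcmpDr.

Definition quotFun : addFun C quot_preadd :=
  @AddFun C quot_preadd (fun X => X) qcls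
    (fun _ => erefl) (fun _ _ _ g f => esym (qclsM g f)) qclsD.

End QuotCat.

Section QuotLift.
Variables (C D : preaddCat) (J : ideal C) (K : ideal D) (F : addFun C D).
Hypothesis FJK : forall X Y (f : hom X Y), idl J f -> idl K (fmor F f).

Definition quot_lift_mor (X Y : C) (u : qhom J X Y) : qhom K (F X) (F Y) :=
  qcls K (fmor F (repr u)).

Lemma quot_lift_morE (X Y : C) (f : hom X Y) :
  quot_lift_mor (qcls J f) = qcls K (fmor F f).
Proof.
by apply/qclsP; rewrite -fmorB; apply: FJK; apply/qclsP; rewrite qclsK.
Qed.

Fact quot_lift1 (X : C) :
  quot_lift_mor (idm (X : quot_preadd J)) = idm (F X : quot_preadd K).
Proof. by rewrite /= quot_lift_morE fmor1. Qed.

Fact quot_liftM (X Y Z : quot_preadd J) (g : hom Y Z) (f : hom X Y) :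
  quot_lift_mor (g \oc f)
  = @cmp (quot_preadd K) _ _ _ (quot_lift_mor g) (quot_lift_mor f).
Proof.
rewrite -(qclsK g) -(qclsK f) /= qclsM !quot_lift_morE.
by rewrite fmorM; apply/esym/qclsM.
Qed.

Fact quot_liftD (X Y : quot_preadd J) (g f : hom X Y) :
  quot_lift_mor (g + f) = quot_lift_mor g + quot_lift_mor f.
Proof.
by rewrite -(qclsK g) -(qclsK f) -qclsD !quot_lift_morE fmorD qclsD.
Qed.

Definition quot_lift : addFun (quot_preadd J) (quot_preadd K) :=
  @AddFun (quot_preadd J) (quot_preadd K) F quot_lift_mor
    quot_lift1 quot_liftM quot_liftD.

End QuotLift.

Section QuotAdd.
Variables (C : addCat) (J : ideal C).
Local Notation Q := (quot_preadd J).
Local Notation q := (fmor (quotFun J)).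

Fact quot_zobP : idm (zob : Q) = 0.
Proof. by rewrite /= zobP qcls0. Qed.
Fact quot_pr1in1 (X Y : C) : q (pr1 X Y) \oc q (in1 X Y) = idm (X : Q).
Proof. by rewrite -fmorM pr1in1. Qed.
Fact quot_pr2in2 (X Y : C) : q (pr2 X Y) \oc q (in2 X Y) = idm (Y : Q).
Proof. by rewrite -fmorM pr2in2. Qed.
Fact quot_pr1in2 (X Y : C) : q (pr1 X Y) \oc q (in2 X Y) = 0.
Proof. by rewrite -fmorM pr1in2 fmor0. Qed.
Fact quot_pr2in1 (X Y : C) : q (pr2 X Y) \oc q (in1 X Y) = 0.
Proof. by rewrite -fmorM pr2in1 fmor0. Qed.
Fact quot_bipE (X Y : C) :
  q (in1 X Y) \oc q (pr1 X Y) + q (in2 X Y) \oc q (pr2 X Y)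
  = idm (bip X Y : Q).
Proof. by rewrite -!fmorM -fmorD bipE. Qed.

Definition quotCat : addCat :=
  @AddCat Q zob bip
    (fun X Y => q (in1 X Y)) (fun X Y => q (in2 X Y))
    (fun X Y => q (pr1 X Y)) (fun X Y => q (pr2 X Y))
    quot_zobP quot_pr1in1 quot_pr2in2 quot_pr1in2 quot_pr2in1 quot_bipE.

End QuotAdd.

Record triangle (C : preaddCat) (Sg : addFun C C) := Triangle {
  tX : C; tY : C; tZ : C;
  tu : hom tX tY;
  tv : hom tY tZ;
  tw : hom tZ (Sg tX) }.

Definition tri_iso (C : preaddCat) (Sg : addFun C C) (t t' : triangle Sg) :
    Prop :=
  exists (a : hom (tX t) (tX t')) (b : hom (tY t) (tY t'))
         (c : hom (tZ t) (tZ t')),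
    [/\ is_iso a, is_iso b & is_iso c] /\
    [/\ b \oc tu t = tu t' \oc a, c \oc tv t = tv t' \oc b
      & fmor Sg a \oc tw t = tw t' \oc c].

(* A category with a suspension functor and a class of distinguished
   triangles, without axioms. *)
Record triData := TriData {
  td_cat :> addCat;
  td_susp : addFun td_cat td_cat;
  td_dist : triangle td_susp -> Prop }.

Arguments td_susp : clear implicits.
Arguments td_dist : clear implicits.

Record triangulated (D : triData) : Prop := Triangulated {
  tr_susp : is_automorphism (td_susp D);
  tr_iso : forall t t', tri_iso t t' -> td_dist D t -> td_dist D t';
  tr_id : forall X : D,
    td_dist D (@Triangle D (td_susp D) X X zob (idm X) 0 0);
  tr_ext : forall (X Y : D) (u : hom X Y),
    exists (Z : D) (v : hom Y Z) (w : hom Z (td_susp D X)),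
      td_dist D (Triangle u v w);
  tr_rot : forall (X Y Z : D) (u : hom X Y) (v : hom Y Z)
                  (w : hom Z (td_susp D X)),
    td_dist D (Triangle u v w) <->
    td_dist D (Triangle v w (- fmor (td_susp D) u));
  tr_mor : forall t t', td_dist D t -> td_dist D t' ->
    forall (a : hom (tX t) (tX t')) (b : hom (tY t) (tY t')),
    b \oc tu t = tu t' \oc a ->
    exists c : hom (tZ t) (tZ t'),
      c \oc tv t = tv t' \oc b /\ fmor (td_susp D) a \oc tw t = tw t' \oc c;
  tr_oct : forall (X Y Z X' Y' Z' : D) (u : hom X Y) (v : hom Y Z)
      (i : hom Y Z') (i' : hom Z' (td_susp D X))
      (j : hom Z X') (j' : hom X' (td_susp D Y))
      (k : hom Z Y') (k' : hom Y' (td_susp D X)),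
    td_dist D (Triangle u i i') ->
    td_dist D (Triangle v j j') ->
    td_dist D (Triangle (v \oc u) k k') ->
    exists (f : hom Z' Y') (g : hom Y' X'),
      td_dist D (Triangle f g (fmor (td_susp D) i \oc j')) /\
      [/\ f \oc i = k \oc v, k' \oc f = i', g \oc k = j
        & j' \oc g = fmor (td_susp D) u \oc k'] }.

(* The image of a triangle under [F], for [th X : F (Sg X) -> Sg' (F X)]. *)
Definition tri_image (D E : triData) (F : addFun D E)
    (th : forall X, hom (F (td_susp D X)) (td_susp E (F X)))
    (t : triangle (td_susp D)) : triangle (td_susp E) :=
  Triangle (fmor F (tu t)) (fmor F (tv t)) (th (tX t) \oc fmor F (tw t)).

Definition tri_equivalent (D E : triData) : Prop :=
  exists (F : addFun D E)
         (th : forall X, hom (F (td_susp D X)) (td_susp E (F X))),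
    [/\ fully_faithful F, ess_surjective F, forall X, is_iso (th X),
        forall X Y (f : hom X Y),
          fmor (td_susp E) (fmor F f) \oc th X
          = th Y \oc fmor F (fmor (td_susp D) f)
      & forall t, td_dist D t -> td_dist E (tri_image th t)].

Section Exact.
Variable A : addCat.
Implicit Types X Y Z W : A.

Definition is_kernel X Y Z (i : hom X Y) (p : hom Y Z) : Prop :=
  p \oc i = 0 /\
  forall W (h : hom W Y), p \oc h = 0 -> exists! k : hom W X, i \oc k = h.

Definition is_cokernel X Y Z (i : hom X Y) (p : hom Y Z) : Prop :=
  p \oc i = 0 /\
  forall W (h : hom Y W), h \oc i = 0 -> exists! k : hom Z W, k \oc p = h.

Definition is_pushout X Y X' Y' (i : hom X Y) (f : hom X X')
    (f' : hom Y Y') (i' : hom X' Y') : Prop :=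
  f' \oc i = i' \oc f /\
  forall W (a : hom Y W) (b : hom X' W), a \oc i = b \oc f ->
    exists! c : hom Y' W, c \oc f' = a /\ c \oc i' = b.

Definition is_pullback Y Z Y' Z' (p : hom Y Z) (f : hom Z' Z)
    (f' : hom Y' Y) (p' : hom Y' Z') : Prop :=
  p \oc f' = f \oc p' /\
  forall W (a : hom W Y) (b : hom W Z'), p \oc a = f \oc b ->
    exists! c : hom W Y', f' \oc c = a /\ p' \oc c = b.

Variable conf : forall X Y Z, hom X Y -> hom Y Z -> Prop.

Definition inflation X Y (i : hom X Y) : Prop :=
  exists (Z : A) (p : hom Y Z), conf i p.

Definition deflation Y Z (p : hom Y Z) : Prop :=
  exists (X : A) (i : hom X Y), conf i p.

Record is_exact : Prop := IsExact {
  ex_ker : forall X Y Z (i : hom X Y) (p : hom Y Z),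
    conf i p -> is_kernel i p;
  ex_coker : forall X Y Z (i : hom X Y) (p : hom Y Z),
    conf i p -> is_cokernel i p;
  ex_iso : forall X Y Z X' Y' Z' (i : hom X Y) (p : hom Y Z)
      (i' : hom X' Y') (p' : hom Y' Z')
      (a : hom X X') (b : hom Y Y') (c : hom Z Z'),
    is_iso a -> is_iso b -> is_iso c ->
    b \oc i = i' \oc a -> c \oc p = p' \oc b -> conf i p -> conf i' p';
  ex_infl_id : forall X, inflation (idm X);
  ex_defl_id : forall X, deflation (idm X);
  ex_infl_cmp : forall X Y Z (i : hom X Y) (j : hom Y Z),
    inflation i -> inflation j -> inflation (j \oc i);
  ex_defl_cmp : forall X Y Z (p : hom X Y) (q : hom Y Z),
    deflation p -> deflation q -> deflation (q \oc p);
  ex_pushout : forall X Y X' (i : hom X Y) (f : hom X X'), inflation i ->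
    exists (Y' : A) (f' : hom Y Y') (i' : hom X' Y'),
      is_pushout i f f' i' /\ inflation i';
  ex_pullback : forall Y Z Z' (p : hom Y Z) (f : hom Z' Z), deflation p ->
    exists (Y' : A) (f' : hom Y' Y) (p' : hom Y' Z'),
      is_pullback p f f' p' /\ deflation p' }.

Definition is_injective (I : A) : Prop :=
  forall X Y (i : hom X Y), inflation i ->
  forall f : hom X I, exists g : hom Y I, g \oc i = f.

Definition is_projective (P : A) : Prop :=
  forall Y Z (p : hom Y Z), deflation p ->
  forall f : hom P Z, exists g : hom P Y, p \oc g = f.

End Exact.

Record frobeniusCat := FrobeniusCat {
  frob_cat :> addCat;
  conflation : forall X Y Z : frob_cat, hom X Y -> hom Y Z -> Prop;
  frob_exact : is_exact conflation;
  frob_inj : forall X : frob_cat, exists (I : frob_cat) (i : hom X I),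
    is_injective conflation I /\ inflation conflation i;
  frob_proj : forall X : frob_cat, exists (P : frob_cat) (p : hom P X),
    is_projective conflation P /\ deflation conflation p;
  frob_projinj : forall P : frob_cat,
    is_projective conflation P <-> is_injective conflation P }.

Arguments conflation : clear implicits.
Arguments conflation f {X Y Z} i p.

(* The conflations X -> I X -> Q X, with I X injective, that define the
   suspension functor of the stable category. *)
Record hulls (E : frobeniusCat) := Hulls {
  hI : E -> E;
  hQ : E -> E;
  hi : forall X, hom X (hI X);
  hp : forall X, hom (hI X) (hQ X);
  hconf : forall X, conflation E (hi X) (hp X);
  hinj : forall X, is_injective (@conflation E) (hI X) }.

Section Stable.
Variable E : frobeniusCat.

Definition stably_zero (X Y : E) (f : hom X Y) : Prop :=
  exists (P : E) (a : hom X P) (b : hom P Y),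
    is_projective (@conflation E) P /\ f = b \oc a.

Fact proj_zob : is_projective (@conflation E) zob.
Proof.
move=> Y Z p _ f; exists 0.
by rewrite cmpm0 -[RHS]cmpm1 zobP cmpm0.
Qed.

Fact proj_bip (P P' : E) : is_projective (@conflation E) P ->
  is_projective (@conflation E) P' -> is_projective (@conflation E) (bip P P').
Proof.
move=> hP hP' Y Z p dp f.
have [g1 e1] := hP _ _ _ dp (f \oc in1 P P').
have [g2 e2] := hP' _ _ _ dp (f \oc in2 P P').
exists (g1 \oc pr1 P P' + g2 \oc pr2 P P').
by rewrite cmpDr !cmpA e1 e2 -!cmpA -cmpDr bipE cmpm1.
Qed.

Fact stable0 (X Y : E) : stably_zero (0 : hom X Y).
Proof. by exists zob, 0, 0; split; [exact: proj_zob | rewrite cmp0m]. Qed.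

Fact stableB (X Y : E) (f g : hom X Y) :
  stably_zero f -> stably_zero g -> stably_zero (f - g).
Proof.
move=> [P [a [b [hP ->]]]] [P' [a' [b' [hP' ->]]]].
exists (bip P P'), (in1 P P' \oc a + in2 P P' \oc a'),
  (b \oc pr1 P P' - b' \oc pr2 P P').
split; first exact: proj_bip.
rewrite cmpBl !cmpDr !cmpA -!(cmpA b) -!(cmpA b').
by rewrite pr1in1 pr1in2 pr2in1 pr2in2 !cmp1m !cmp0m !cmpm0 addr0 add0r.
Qed.

Fact stableL (X Y Z : E) (g : hom Y Z) (f : hom X Y) :
  stably_zero f -> stably_zero (g \oc f).
Proof. by move=> [P [a [b [hP ->]]]]; exists P, a, (g \oc b); rewrite cmpA. Qed.

Fact stableR (X Y Z : E) (g : hom Y Z) (f : hom X Y) :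
  stably_zero g -> stably_zero (g \oc f).
Proof. by move=> [P [a [b [hP ->]]]]; exists P, (a \oc f), b; rewrite cmpA. Qed.

Definition stable_ideal : ideal E := Ideal stable0 stableB stableL stableR.

Definition stableCat : addCat := quotCat stable_ideal.

Variable H : hulls E.

Definition hull_square (X Y : E) (f : hom X Y) (n : hom (hQ H X) (hQ H Y)) :
    Prop :=
  exists m : hom (hI H X) (hI H Y),
    m \oc hi H X = hi H Y \oc f /\ n \oc hp H X = hp H Y \oc m.

Fact hull_square_ex (X Y : E) (f : hom X Y) :
  exists n : hom (hQ H X) (hQ H Y), hull_square f n.
Proof.
have iX : inflation (@conflation E) (hi H X).
  by exists (hQ H X), (hp H X); exact: hconf.
have [m em] := hinj iX (hi H Y \oc f).
have [_ cX] := ex_coker (frob_exact E) (hconf H X).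
have [pi0 _] := ex_coker (frob_exact E) (hconf H Y).
have [|n [en _]] := cX _ (hp H Y \oc m).
  by rewrite -cmpA em cmpA pi0 cmp0m.
by exists n, m.
Qed.

Fact hull_square_stable (X Y : E) (f : hom X Y) n :
  hull_square f n -> stably_zero f -> stably_zero n.
Proof.
move=> [m [em en]] [P [a [b [hP ef]]]].
have iX : inflation (@conflation E) (hi H X).
  by exists (hQ H X), (hp H X); exact: hconf.
have [a' ea] := (frob_projinj P).1 hP _ _ _ iX a.
have [_ cX] := ex_coker (frob_exact E) (hconf H X).
have [pi0 _] := ex_coker (frob_exact E) (hconf H Y).
have [|c [ec _]] := cX _ (m - hi H Y \oc b \oc a').
  by rewrite cmpBl em ef -!cmpA ea subrr.
exists (hI H Y), c, (hp H Y); split; first exact/frob_projinj/hinj.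
have [|u [_ uu]] := cX _ (n \oc hp H X).
  have [pX0 _] := ex_coker (frob_exact E) (hconf H X).
  by rewrite -cmpA pX0 cmpm0.
rewrite -(uu n) // -(uu (hp H Y \oc c)) //.
by rewrite -cmpA ec cmpBr !cmpA pi0 !cmp0m subr0.
Qed.

Fact hull_squareB (X Y : E) (f f' : hom X Y) n n' :
  hull_square f n -> hull_square f' n' -> hull_square (f - f') (n - n').
Proof.
move=> [m [em en]] [m' [em' en']]; exists (m - m').
by rewrite !cmpBl !cmpBr em em' en en'.
Qed.

Fact hull_squareM (X Y Z : E) (g : hom Y Z) (f : hom X Y) n n' :
  hull_square g n -> hull_square f n' -> hull_square (g \oc f) (n \oc n').
Proof.
move=> [m [em en]] [m' [em' en']]; exists (m \oc m').
by split; [rewrite -cmpA em' !cmpA em | rewrite -cmpA en' !cmpA en].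
Qed.

Fact hull_square1 (X : E) : hull_square (idm X) (idm _).
Proof. by exists (idm _); rewrite !cmp1m !cmpm1. Qed.

Definition stable_susp_mor (X Y : stableCat) (u : hom X Y) :
    @hom stableCat (hQ H X) (hQ H Y) :=
  qcls stable_ideal (sval (cid (hull_square_ex (repr u)))).

Lemma stable_susp_morE (X Y : E) (f : hom X Y) n :
  hull_square f n ->
  stable_susp_mor (qcls stable_ideal f) = qcls stable_ideal n.
Proof.
move=> fn; rewrite /stable_susp_mor; case: cid => n' /= fn'.
apply/qclsP; apply: (hull_square_stable (hull_squareB fn' fn)).
by apply/(qclsP stable_ideal); rewrite qclsK.
Qed.

Fact stable_susp1 (X : stableCat) :
  stable_susp_mor (idm X) = @idm stableCat (hQ H X).
Proof. by rewrite (stable_susp_morE (hull_square1 X)). Qed.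

Fact stable_suspM (X Y Z : stableCat) (g : hom Y Z) (f : hom X Y) :
  stable_susp_mor (g \oc f) = stable_susp_mor g \oc stable_susp_mor f.
Proof.
rewrite -(qclsK g) -(qclsK f) /=.
have [n gn] := hull_square_ex (repr g); have [n' fn'] := hull_square_ex (repr f).
rewrite (stable_susp_morE gn) (stable_susp_morE fn') !qclsM.
exact: stable_susp_morE (hull_squareM gn fn').
Qed.

Fact stable_suspD (X Y : stableCat) (g f : hom X Y) :
  stable_susp_mor (g + f) = stable_susp_mor g + stable_susp_mor f.
Proof.
rewrite -(qclsK g) -(qclsK f) /=.
have [n gn] := hull_square_ex (repr g); have [n' fn'] := hull_square_ex (repr f).
rewrite (stable_susp_morE gn) (stable_susp_morE fn') -!qclsD.
apply: stable_susp_morE; case: gn fn' => [m [em en]] [m' [em' en']].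
by exists (m + m'); rewrite !cmpDl !cmpDr em em' en en'.
Qed.

Definition stable_susp : addFun stableCat stableCat :=
  AddFun stable_susp1 stable_suspM stable_suspD.

(* The standard triangle of f : X -> Y is given by the pushout Z of
   X -> I X along f, with the induced map Z -> Q X. *)
Inductive stable_standard : triangle stable_susp -> Prop :=
| StableStandard (X Y Z : E) (f : hom X Y) (k : hom (hI H X) Z)
    (g : hom Y Z) (h : hom Z (hQ H X)) :
    is_pushout (hi H X) f k g -> h \oc k = hp H X -> h \oc g = 0 ->
    stable_standard (@Triangle stableCat stable_susp X Y Z
      (qcls stable_ideal f) (qcls stable_ideal g) (qcls stable_ideal h)).

Definition stable_tri : triData :=
  @TriData stableCat stable_susp
    (fun t => exists2 t', stable_standard t' & tri_iso t' t).

End Stable.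

(* Of the three equivalent characterizations of algebraic triangulated
   categories, this is the one by Frobenius exact categories. *)
Definition algebraic (D : triData) : Prop :=
  exists (E : frobeniusCat) (H : hulls E), tri_equivalent D (stable_tri H).

Record suspCat := SuspCat {
  sc_cat :> addCat;
  susp : addFun sc_cat sc_cat;
  susp_aut : is_automorphism susp }.

Arguments susp : clear implicits.

Record suspNat (C : suspCat) := SuspNat {
  eta :> forall M : C, hom M (susp C M);
  eta_nat : forall (M N : C) (f : hom M N),
    eta N \oc f = fmor (susp C) f \oc eta M;
  eta_susp : forall M : C, eta (susp C M) = fmor (susp C) (eta M) }.

Section Families.
Variables (C : suspCat) (d : nat).
Local Notation S := (susp C).
Local Notation fam := ('I_d -> C).

Definition fhom (M N : fam) : Type := forall i, hom (M i) (N i).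

Section FhomZmod.
Variables M N : fam.

HB.instance Definition _ :=
  Choice.copy (fhom M N) (forall i, hom (M i) (N i)).

Definition fhom_add (f g : fhom M N) : fhom M N := fun i => f i + g i.
Definition fhom_opp (f : fhom M N) : fhom M N := fun i => - f i.
Definition fhom_zero : fhom M N := fun=> 0.

Fact fhom_addA : associative fhom_add.
Proof. by move=> f g h; apply: functional_extensionality_dep => i; exact: addrA. Qed.
Fact fhom_addC : commutative fhom_add.
Proof. by move=> f g; apply: functional_extensionality_dep => i; exact: addrC. Qed.
Fact fhom_add0 : left_id fhom_zero fhom_add.
Proof. by move=> f; apply: functional_extensionality_dep => i; exact: add0r. Qed.
Fact fhom_addN : left_inverse fhom_zero fhom_opp fhom_add.
Proof. by move=> f; apply: functional_extensionality_dep => i; exact: addNr. Qed.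

HB.instance Definition _ := GRing.isZmodule.Build (fhom M N)
  fhom_addA fhom_addC fhom_add0 fhom_addN.

End FhomZmod.

Definition fcmp (M N P : fam) (g : fhom N P) (f : fhom M N) : fhom M P :=
  fun i => g i \oc f i.

Fact fcmpA (M N P Q : fam) (h : fhom P Q) (g : fhom N P) (f : fhom M N) :
  fcmp h (fcmp g f) = fcmp (fcmp h g) f.
Proof. by apply: functional_extensionality_dep => i; exact: cmpA. Qed.
Fact fcmp1m (M N : fam) (f : fhom M N) : fcmp (fun i => idm (N i)) f = f.
Proof. by apply: functional_extensionality_dep => i; exact: cmp1m. Qed.
Fact fcmpm1 (M N : fam) (f : fhom M N) : fcmp f (fun i => idm (M i)) = f.
Proof. by apply: functional_extensionality_dep => i; exact: cmpm1. Qed.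
Fact fcmpDl (M N P : fam) (g g' : fhom N P) (f : fhom M N) :
  fcmp (g + g') f = fcmp g f + fcmp g' f.
Proof. by apply: functional_extensionality_dep => i; exact: cmpDl. Qed.
Fact fcmpDr (M N P : fam) (g : fhom N P) (f f' : fhom M N) :
  fcmp g (f + f') = fcmp g f + fcmp g f'.
Proof. by apply: functional_extensionality_dep => i; exact: cmpDr. Qed.

Definition fam_preadd : preaddCat :=
  @PreaddCat fam fhom (fun M i => idm (M i)) fcmp
    fcmpA fcmp1m fcmpm1 fcmpDl fcmpDr.

Definition fbip (M N : fam) : fam := fun i => bip (M i) (N i).

Fact fam_zobP : @idm fam_preadd (fun=> zob) = 0.
Proof. by apply: functional_extensionality_dep => i; exact: zobP. Qed.
Fact fam_pr1in1 (M N : fam_preadd) :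
  @cmp fam_preadd M (fbip M N) M (fun i => pr1 _ _) (fun i => in1 _ _) = idm M.
Proof. by apply: functional_extensionality_dep => i; exact: pr1in1. Qed.
Fact fam_pr2in2 (M N : fam_preadd) :
  @cmp fam_preadd N (fbip M N) N (fun i => pr2 _ _) (fun i => in2 _ _) = idm N.
Proof. by apply: functional_extensionality_dep => i; exact: pr2in2. Qed.
Fact fam_pr1in2 (M N : fam_preadd) :
  @cmp fam_preadd N (fbip M N) M (fun i => pr1 _ _) (fun i => in2 _ _) = 0.
Proof. by apply: functional_extensionality_dep => i; exact: pr1in2. Qed.
Fact fam_pr2in1 (M N : fam_preadd) :
  @cmp fam_preadd M (fbip M N) N (fun i => pr2 _ _) (fun i => in1 _ _) = 0.
Proof. by apply: functional_extensionality_dep => i; exact: pr2in1. Qed.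
Fact fam_bipE (M N : fam_preadd) :
  @cmp fam_preadd (fbip M N) M (fbip M N) (fun i => in1 _ _) (fun i => pr1 _ _)
  + @cmp fam_preadd (fbip M N) N (fbip M N)
      (fun i => in2 _ _) (fun i => pr2 _ _) = idm (fbip M N : fam_preadd).
Proof. by apply: functional_extensionality_dep => i; exact: bipE. Qed.

Definition famCat : addCat :=
  @AddCat fam_preadd (fun=> zob) fbip
    (fun M N i => in1 (M i) (N i)) (fun M N i => in2 (M i) (N i))
    (fun M N i => pr1 (M i) (N i)) (fun M N i => pr2 (M i) (N i))
    fam_zobP fam_pr1in1 fam_pr2in2 fam_pr1in2 fam_pr2in1 fam_bipE.

Definition twist (b : bool) : addFun C C := if b then idFun C else S.

(* [shift] sends (M_1, ..., M_d) to (M_2, ..., M_d, S M_1), so that a morphism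
   M -> shift M is a sequence M_1 -> M_2 -> ... -> M_d -> S M_1.  Indices start
   at 0 here, and [ordS] is the cyclic successor of 'I_d. *)
Definition shift_ob (M : famCat) : famCat :=
  fun i => twist (i.+1 < d)%N (M (ordS i)).

Definition shift_mor (M N : famCat) (f : hom M N) :
    hom (shift_ob M) (shift_ob N) :=
  fun i => fmor (twist (i.+1 < d)%N) (f (ordS i)).

Fact shift1 (M : famCat) : shift_mor (idm M) = idm (shift_ob M).
Proof. by apply: functional_extensionality_dep => i; exact: fmor1. Qed.
Fact shiftM (M N P : famCat) (g : hom N P) (f : hom M N) :
  shift_mor (g \oc f) = shift_mor g \oc shift_mor f.
Proof. by apply: functional_extensionality_dep => i; exact: fmorM. Qed.
Fact shiftD (M N : famCat) (f f' : hom M N) :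
  shift_mor (f + f') = shift_mor f + shift_mor f'.
Proof. by apply: functional_extensionality_dep => i; exact: fmorD. Qed.

Definition shift : addFun famCat famCat := AddFun shift1 shiftM shiftD.

Lemma inj_surj_bij (A B : Type) (f : A -> B) :
  injective f -> (forall y, exists x, f x = y) -> bijective f.
Proof.
move=> finj fsurj; exists (fun y => sval (cid (fsurj y))) => x.
  by case: cid => y /= /finj.
by case: cid.
Qed.

Lemma twist_ff b : fully_faithful (twist b).
Proof. by case: b => [X Y|]; [exists id | exact: (susp_aut C).2]. Qed.

Lemma shift_ff : fully_faithful shift.
Proof.
move=> M N; apply: inj_surj_bij => [f g|h] /=.
  move=> /(congr1 (fun k : fhom _ _ => k (ord_pred _))) efg.
  apply: functional_extensionality_dep => i; rewrite -(ord_predK i).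
  by have := efg i; rewrite /shift_mor => /(fmor_inj (@twist_ff _)).
pose p i := fmor_inv (@twist_ff _) (h i).
exists (fun j => eq_rect _ (fun j => hom (M j) (N j)) (p (ord_pred j)) j
                   (ord_predK j)).
apply: functional_extensionality_dep => i.
rewrite /shift_mor -[RHS](fmor_invK (@twist_ff _)); congr (fmor _ _).
move: (ord_predK (ordS i)); rewrite ordSK => e.
by rewrite (Prop_irrelevance e erefl).
Qed.

Fixpoint iter_shift_mor k (M N : famCat) (f : hom M N) :
    hom (iter k shift M) (iter k shift N) :=
  if k is k'.+1 then fmor shift (iter_shift_mor k' f) else f.

Definition cyc (U : Type) (s : U -> U) (m : 'I_d -> U) : 'I_d -> U :=
  fun i => if (i.+1 < d)%N then m (ordS i) else s (m (ordS i)).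

Lemma iter_cyc (U : Type) (s : U -> U) (m : 'I_d -> U) i :
  iter d (cyc s) m i = s (m i).
Proof.
have step (j : 'I_d) : (j.+1 < d)%N -> ordS j = j.+1 :> nat.
  by move=> h /=; rewrite modn_small.
have A k : forall (n : 'I_d -> U) (i j : 'I_d), (i + k = j)%N ->
    iter k (cyc s) n i = n j.
  elim: k => [|k IH] n i0 j /= e; first by congr n; apply: val_inj; rewrite -[RHS]e addn0.
  have h : (i0.+1 < d)%N by apply: leq_ltn_trans (ltn_ord j); rewrite -e addnS ltnS leq_addr.
  by rewrite /cyc h; apply: IH; rewrite step // addSnnS.
have d0 : (0 < d)%N by apply: leq_ltn_trans (ltn_ord i).
have B k : forall (n : 'I_d -> U) (i : 'I_d), (i + k = d)%N ->
    iter k (cyc s) n i = s (n (Ordinal d0)).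
  elim: k => [|k IH] n i0 /= e; first by move: (ltn_ord i0); rewrite -[X in (_ < X)%N]e addn0 ltnn.
  rewrite /cyc; case: ltnP => h; first by apply: IH; rewrite step // addSnnS.
  have e1 : i0.+1 = d by apply/eqP; rewrite eqn_leq ltn_ord h.
  have k0 : k = 0 by apply: (@addnI i0.+1); rewrite addn0 addSnnS e e1.
  by rewrite k0 /=; congr (s (n _)); apply: val_inj; rewrite /= e1 modnn.
have id_ : (i + (d - i))%N = d by rewrite subnKC // ltnW.
have di : d = (d - i + i)%N by rewrite subnK // ltnW.
have -> : iter d (cyc s) m = iter (d - i + i) (cyc s) m by rewrite -di.
by rewrite iterD B // (A _ _ _ i).
Qed.

Lemma iter_shift_cyc k (M : famCat) i : iter k shift M i = iter k (cyc S) M i.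
Proof.
by elim: k i => //= k IH i; rewrite /shift_ob /cyc -IH; case: (_ < _)%N.
Qed.

Lemma iter_shift (M : famCat) i : iter d shift M i = S (M i).
Proof. by rewrite iter_shift_cyc iter_cyc. Qed.

End Families.

Arguments shift {C d}.

(* The identity morphism along an equality of objects. *)
Definition eqhom (C : preaddCat) (X Y : C) (e : X = Y) : hom X Y :=
  eq_rect X (fun Z => hom X Z) (idm X) Y e.

Lemma eqhom1 (C : preaddCat) (X : C) (e : X = X) : eqhom e = idm X.
Proof. by rewrite (_ : e = erefl) //; exact: Prop_irrelevance. Qed.

Lemma eqhomM (C : preaddCat) (X Y Z : C) (e : X = Y) (e' : Y = Z) (e2 : X = Z) :
  eqhom e' \oc eqhom e = eqhom e2.
Proof. by subst Z; subst Y; rewrite !eqhom1 cmp1m. Qed.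

Lemma eqhom_fmor (C D : preaddCat) (F : addFun C D) (X Y : C) (e : X = Y)
  (e' : F X = F Y) : fmor F (eqhom e) = eqhom e'.
Proof. by subst Y; rewrite !eqhom1 fmor1. Qed.

Record arrow (C : preaddCat) := Arrow { adom : C; acod : C; amor : hom adom acod }.

Arguments Arrow {C adom acod} amor.

Lemma arrow_eqhom (C : preaddCat) (a b : arrow C) (e1 : adom a = adom b) (e2 : acod a = acod b) :
  a = b -> eqhom e2 \oc amor a = amor b \oc eqhom e1.
Proof. by move=> ab; subst b; rewrite !eqhom1 cmp1m cmpm1. Qed.

Section Factorizations.
Variables (C : suspCat) (d : nat).
Local Notation S := (susp C).
Local Notation famCat := (famCat C d).
Implicit Types (M N P Q : famCat).

(* The i-th component of [pw f k] is the k-fold composite starting with f_i; for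
   k = d it is S f_(i-1) o ... o S f_1 o f_d o ... o f_i. *)
Fixpoint pw M (f : hom M (shift M)) k : hom M (iter k shift M) :=
  if k is k'.+1 then fmor shift (pw f k') \oc f else idm M.

Variable eta : suspNat C.

(* [iter d shift M] is pointwise, but not definitionally, S M. *)
Definition factorizes M (f : hom M (shift M)) : Prop :=
  forall i, eqhom (iter_shift M i) \oc pw f d i = eta (M i).

Record factorization := Factorization {
  fa_ob :> famCat;
  fa_mor : hom fa_ob (shift fa_ob);
  fa_factorizes : factorizes fa_mor }.

Lemma iter_shift_nat M N (h : hom M N) i :
  eqhom (iter_shift N i) \oc iter_shift_mor d h i
  = fmor S (h i) \oc eqhom (iter_shift M i).
Proof.
pose Sarr (a : arrow C) := Arrow (fmor S (amor a)).
have E k : forall j, Arrow (iter_shift_mor k h j)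
    = iter k (cyc Sarr) (fun j => Arrow (h j)) j.
  elim: k => [//|k IH] j; rewrite [RHS]/= [RHS]/cyc -IH /= /shift_mor /shift_ob.
  by case: (_ < _)%N.
have := E d i; rewrite iter_cyc => e.
exact: (@arrow_eqhom C (Arrow (iter_shift_mor d h i)) (Sarr (Arrow (h i)))
          (iter_shift M i) (iter_shift N i) e).
Qed.

Lemma pw_mor M N (f : hom M (shift M)) (g : hom N (shift N)) (h : hom M N) k :
  fmor shift h \oc f = g \oc h ->
  iter_shift_mor k h \oc pw f k = pw g k \oc h.
Proof.
move=> fgh; elim: k => [|k IH]; first by rewrite cmp1m cmpm1.
by rewrite [LHS]cmpA -fmorM IH fmorM -cmpA fgh cmpA.
Qed.

Lemma pw_mor2 M N (f : hom M (shift M)) (g : hom N (shift N)) (h : hom M N) k :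
  ~~ odd k ->
  fmor shift (fmor shift h) \oc (fmor shift f \oc f)
  = fmor shift g \oc g \oc h ->
  iter_shift_mor k h \oc pw f k = pw g k \oc h.
Proof.
move=> k_even fgh; rewrite -(even_halfK k_even); move: k./2 => {k_even}k.
elim: k => [|k IH]; first by rewrite cmp1m cmpm1.
rewrite doubleS -[LHS]/(fmor shift (fmor shift (iter_shift_mor k.*2 h)) \oc
   (fmor shift (fmor shift (pw f k.*2) \oc f) \oc f)).
rewrite [fmor shift (_ \oc f)]fmorM -[_ \oc fmor shift f \oc f]cmpA.
rewrite [LHS]cmpA -!fmorM IH !fmorM -cmpA fgh.
by rewrite -[pw g _.+2]/(fmor shift (fmor shift (pw g k.*2) \oc g) \oc g) fmorM !cmpA.
Qed.

Lemma pw_opp M (f : hom M (shift M)) k : ~~ odd k -> pw (- f) k = pw f k.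
Proof.
move=> k_even; rewrite -(even_halfK k_even); move: k./2 => {k_even}k.
elim: k => [//|k IH]; rewrite doubleS -[LHS]/(fmor shift (fmor shift (pw (- f) k.*2) \oc (- f)) \oc - f).
by rewrite IH !cmpmN fmorN cmpNm opprK.
Qed.

Lemma factorizes_cover M N P (f : hom M (shift M)) (g : hom N (shift N))
    (e : hom P (shift P)) (j1 : hom M P) (j2 : hom N P)
    (p1 : hom P M) (p2 : hom P N) :
  factorizes f -> factorizes g ->
  iter_shift_mor d j1 \oc pw f d = pw e d \oc j1 ->
  iter_shift_mor d j2 \oc pw g d = pw e d \oc j2 ->
  j1 \oc p1 + j2 \oc p2 = idm P -> factorizes e.
Proof.
move=> ff fg h1 h2 idP i.
have aux (Q : famCat) (q : hom Q (shift Q)) (j : hom Q P) : factorizes q ->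
    iter_shift_mor d j \oc pw q d = pw e d \oc j ->
    eqhom (iter_shift P i) \oc pw e d i \oc j i = eta (P i) \oc j i.
  move=> fq /(congr1 (fun k : fhom _ _ => k i)) /= h.
  by rewrite -cmpA -[_ \oc j i]h cmpA iter_shift_nat -cmpA fq eta_nat.
have idPi : j1 i \oc p1 i + j2 i \oc p2 i = idm (P i).
  exact: (congr1 (fun k : fhom _ _ => k i) idP).
rewrite -[LHS]cmpm1 -[RHS]cmpm1 -idPi !cmpDr !cmpA.
by rewrite (aux _ _ _ ff h1) (aux _ _ _ fg h2).
Qed.

Record fact_hom (M N : factorization) := FactHom {
  fh_val :> hom (M : famCat) (N : famCat);
  fh_comm : fmor shift fh_val \oc fa_mor M = fa_mor N \oc fh_val }.

Lemma fact_hom_eq (M N : factorization) (f g : fact_hom M N) :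
  fh_val f = fh_val g -> f = g.
Proof.
case: f g => [f ef] [g eg] /= fg; subst g.
by rewrite (Prop_irrelevance ef eg).
Qed.

Section FactHomZmod.
Variables M N : factorization.

HB.instance Definition _ := gen_eqMixin (fact_hom M N).
HB.instance Definition _ := gen_choiceMixin (fact_hom M N).

Fact fact_add_comm (f g : fact_hom M N) :
  fmor shift (fh_val f + fh_val g) \oc fa_mor M
  = fa_mor N \oc (fh_val f + fh_val g).
Proof. by rewrite fmorD cmpDl cmpDr !fh_comm. Qed.
Fact fact_opp_comm (f : fact_hom M N) :
  fmor shift (- fh_val f) \oc fa_mor M = fa_mor N \oc (- fh_val f).
Proof. by rewrite fmorN cmpNm cmpmN fh_comm. Qed.
Fact fact_zero_comm :
  fmor shift (0 : hom (M : famCat) (N : famCat)) \oc fa_mor M = fa_mor N \oc 0.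
Proof. by rewrite fmor0 cmp0m cmpm0. Qed.

Definition fact_add (f g : fact_hom M N) := FactHom (fact_add_comm f g).
Definition fact_opp (f : fact_hom M N) := FactHom (fact_opp_comm f).
Definition fact_zero := FactHom fact_zero_comm.

Fact fact_addA : associative fact_add.
Proof. by move=> f g h; apply: fact_hom_eq; exact: addrA. Qed.
Fact fact_addC : commutative fact_add.
Proof. by move=> f g; apply: fact_hom_eq; exact: addrC. Qed.
Fact fact_add0 : left_id fact_zero fact_add.
Proof. by move=> f; apply: fact_hom_eq; exact: add0r. Qed.
Fact fact_addN : left_inverse fact_zero fact_opp fact_add.
Proof. by move=> f; apply: fact_hom_eq; exact: addNr. Qed.

HB.instance Definition _ := GRing.isZmodule.Build (fact_hom M N)
  fact_addA fact_addC fact_add0 fact_addN.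

End FactHomZmod.

Fact fact_id_comm (M : factorization) :
  fmor shift (idm (M : famCat)) \oc fa_mor M = fa_mor M \oc idm (M : famCat).
Proof. by rewrite fmor1 cmp1m cmpm1. Qed.
Definition fact_id (M : factorization) := FactHom (fact_id_comm M).

Fact fact_cmp_comm (M N P : factorization) (g : fact_hom N P)
  (f : fact_hom M N) :
  fmor shift (fh_val g \oc fh_val f) \oc fa_mor M
  = fa_mor P \oc (fh_val g \oc fh_val f).
Proof. by rewrite fmorM -cmpA fh_comm cmpA fh_comm cmpA. Qed.
Definition fact_cmp (M N P : factorization) (g : fact_hom N P)
  (f : fact_hom M N) : fact_hom M P := FactHom (fact_cmp_comm g f).

Fact fact_cmpA (M N P Q : factorization) (h : fact_hom P Q)
  (g : fact_hom N P) (f : fact_hom M N) :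
  fact_cmp h (fact_cmp g f) = fact_cmp (fact_cmp h g) f.
Proof. by apply: fact_hom_eq; exact: cmpA. Qed.
Fact fact_cmp1m (M N : factorization) (f : fact_hom M N) :
  fact_cmp (fact_id N) f = f.
Proof. by apply: fact_hom_eq; exact: cmp1m. Qed.
Fact fact_cmpm1 (M N : factorization) (f : fact_hom M N) :
  fact_cmp f (fact_id M) = f.
Proof. by apply: fact_hom_eq; exact: cmpm1. Qed.
Fact fact_cmpDl (M N P : factorization) (g g' : fact_hom N P)
  (f : fact_hom M N) :
  fact_cmp (g + g') f = fact_cmp g f + fact_cmp g' f.
Proof. by apply: fact_hom_eq; exact: cmpDl. Qed.
Fact fact_cmpDr (M N P : factorization) (g : fact_hom N P)
  (f f' : fact_hom M N) :
  fact_cmp g (f + f') = fact_cmp g f + fact_cmp g f'.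
Proof. by apply: fact_hom_eq; exact: cmpDr. Qed.

Definition fact_preadd : preaddCat :=
  @PreaddCat factorization fact_hom fact_id fact_cmp
    fact_cmpA fact_cmp1m fact_cmpm1 fact_cmpDl fact_cmpDr.

Fact fact_zob_factorizes :
  factorizes (0 : hom (zob : famCat) (shift zob)).
Proof.
move=> i; rewrite -[LHS]cmpm1 -[RHS]cmpm1.
have -> : idm ((zob : famCat) i) = 0 by exact: zobP.
by rewrite !cmpm0.
Qed.

Definition fact_zob : factorization := Factorization fact_zob_factorizes.

Section FactBip.
Variables M N : factorization.

Definition fact_bip_mor : hom (bip (M : famCat) N) (shift (bip (M : famCat) N)) :=
  fmor shift (in1 (M : famCat) N) \oc fa_mor M \oc pr1 (M : famCat) N
  + fmor shift (in2 (M : famCat) N) \oc fa_mor N \oc pr2 (M : famCat) N.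

Fact fact_in1_comm :
  fmor shift (in1 (M : famCat) N) \oc fa_mor M
  = fact_bip_mor \oc in1 (M : famCat) N.
Proof.
by rewrite cmpDl -!(cmpA _ _ (in1 _ _)) pr1in1 pr2in1 cmpm1 cmpm0 addr0.
Qed.
Fact fact_in2_comm :
  fmor shift (in2 (M : famCat) N) \oc fa_mor N
  = fact_bip_mor \oc in2 (M : famCat) N.
Proof.
by rewrite cmpDl -!(cmpA _ _ (in2 _ _)) pr1in2 pr2in2 cmpm1 cmpm0 add0r.
Qed.
Fact fact_pr1_comm :
  fmor shift (pr1 (M : famCat) N) \oc fact_bip_mor
  = fa_mor M \oc pr1 (M : famCat) N.
Proof.
by rewrite cmpDr !cmpA -!fmorM pr1in1 pr1in2 fmor1 fmor0 cmp1m !cmp0m addr0.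
Qed.
Fact fact_pr2_comm :
  fmor shift (pr2 (M : famCat) N) \oc fact_bip_mor
  = fa_mor N \oc pr2 (M : famCat) N.
Proof.
by rewrite cmpDr !cmpA -!fmorM pr2in1 pr2in2 fmor1 fmor0 cmp1m !cmp0m add0r.
Qed.

Fact fact_bip_factorizes : factorizes fact_bip_mor.
Proof.
apply: (factorizes_cover (@fa_factorizes M) (@fa_factorizes N) _ _
  (bipE (M : famCat) N)); apply: pw_mor.
  exact: fact_in1_comm.
exact: fact_in2_comm.
Qed.

Definition fact_bip : factorization := Factorization fact_bip_factorizes.
Definition fact_in1 : fact_hom M fact_bip :=
  @FactHom M fact_bip _ fact_in1_comm.
Definition fact_in2 : fact_hom N fact_bip :=
  @FactHom N fact_bip _ fact_in2_comm.
Definition fact_pr1 : fact_hom fact_bip M :=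
  @FactHom fact_bip M _ fact_pr1_comm.
Definition fact_pr2 : fact_hom fact_bip N :=
  @FactHom fact_bip N _ fact_pr2_comm.

Fact fact_pr1in1 : fact_cmp fact_pr1 fact_in1 = fact_id M.
Proof. by apply: fact_hom_eq; exact: pr1in1. Qed.
Fact fact_pr2in2 : fact_cmp fact_pr2 fact_in2 = fact_id N.
Proof. by apply: fact_hom_eq; exact: pr2in2. Qed.
Fact fact_pr1in2 : fact_cmp fact_pr1 fact_in2 = 0.
Proof. by apply: fact_hom_eq; exact: pr1in2. Qed.
Fact fact_pr2in1 : fact_cmp fact_pr2 fact_in1 = 0.
Proof. by apply: fact_hom_eq; exact: pr2in1. Qed.
Fact fact_bipE :
  fact_cmp fact_in1 fact_pr1 + fact_cmp fact_in2 fact_pr2 = fact_id fact_bip.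
Proof. by apply: fact_hom_eq; exact: bipE. Qed.

End FactBip.

Fact fact_zobP : fact_id fact_zob = 0.
Proof. by apply: fact_hom_eq; exact: zobP. Qed.

Definition FactCat : addCat :=
  @AddCat fact_preadd fact_zob fact_bip fact_in1 fact_in2 fact_pr1 fact_pr2
    fact_zobP fact_pr1in1 fact_pr2in2 fact_pr1in2 fact_pr2in1 fact_bipE.

(* s consists of s_i : M_(i+1) -> N_i for i < d and s_d : S M_1 -> N_d, and
   [fmor_inv] applies S^-1 to the composite S M_1 -> N_d -> S N_1. *)
Definition homotopic (M N : FactCat) (f f' : hom M N) : Prop :=
  exists s : hom (shift M) N,
    fh_val f - fh_val f'
    = s \oc fa_mor M + fmor_inv (@shift_ff C d) (fa_mor N \oc s).

Lemma homotopicP (M N : FactCat) (f f' : hom M N) :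
  homotopic f f' <-> exists s : hom (shift M) N,
    fmor shift (fh_val f - fh_val f')
    = fmor shift (s \oc fa_mor M) + fa_mor N \oc s.
Proof.
split=> [[s es]|[s es]]; exists s.
  by rewrite es fmorD fmor_invK.
by apply: (fmor_inj (@shift_ff C d)); rewrite es fmorD fmor_invK.
Qed.

Definition null_homotopic (M N : FactCat) (f : hom M N) : Prop :=
  homotopic f 0.

Fact null0 (M N : FactCat) : null_homotopic (0 : hom M N).
Proof.
apply/homotopicP; exists 0.
by rewrite subr0 cmp0m cmpm0 !fmor0 addr0.
Qed.

Fact nullB (M N : FactCat) (f g : hom M N) :
  null_homotopic f -> null_homotopic g -> null_homotopic (f - g).
Proof.
move=> /homotopicP[s es] /homotopicP[t et]; apply/homotopicP; exists (s - t).
rewrite subr0 in es; rewrite subr0 in et.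
rewrite subr0 [fh_val _]/(fh_val f - fh_val g) fmorB es et.
by rewrite cmpBl cmpBr fmorB opprD addrACA.
Qed.

Fact nullL (M N P : FactCat) (g : hom N P) (f : hom M N) :
  null_homotopic f -> null_homotopic (g \oc f).
Proof.
move=> /homotopicP[s es]; apply/homotopicP; exists (fh_val g \oc s).
rewrite subr0 in es.
rewrite subr0 -[fh_val _]/(fh_val g \oc fh_val f) fmorM es cmpDr -!fmorM.
by rewrite !cmpA fh_comm.
Qed.

Fact nullR (M N P : FactCat) (g : hom N P) (f : hom M N) :
  null_homotopic g -> null_homotopic (g \oc f).
Proof.
move=> /homotopicP[s es]; apply/homotopicP; exists (s \oc fmor shift (fh_val f)).
rewrite subr0 in es.
rewrite subr0 -[fh_val _]/(fh_val g \oc fh_val f) fmorM es cmpDl -!fmorM.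
by rewrite -!cmpA fh_comm.
Qed.

Definition null_ideal : ideal FactCat := Ideal null0 nullB nullL nullR.

Definition HFactCat : addCat := quotCat null_ideal.

Definition hcls (M N : FactCat) (f : hom M N) : @hom HFactCat M N :=
  qcls null_ideal f.

Lemma hclsP (M N : FactCat) (f g : hom M N) : hcls f = hcls g <-> homotopic f g.
Proof.
by rewrite qclsP; split=> -[s es]; exists s; rewrite -es ?subr0.
Qed.

Hypothesis d_even : ~~ odd d.

Lemma pw_shift M (f : hom M (shift M)) k :
  exists e : iter k shift (shift M) = shift (iter k shift M),
    eqhom e \oc pw (fmor shift f) k = fmor shift (pw f k).
Proof.
elim: k => [|k [e IH]]; first by exists erefl; rewrite eqhom1 cmpm1 fmor1.
have e' : iter k.+1 shift (shift M) = shift (iter k.+1 shift M).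
  by rewrite [LHS]/= [X in shift_ob X]e.
exists e'.
rewrite -[pw _ k.+1]/(fmor shift (pw (fmor shift f) k) \oc fmor shift f).
rewrite -(eqhom_fmor (F := shift) e e') cmpA -fmorM IH.
by rewrite -fmorM.
Qed.

Lemma factorizes_shift M (f : hom M (shift M)) :
  factorizes f -> factorizes (fmor shift f).
Proof.
move=> ff i; have [e he] := pw_shift f d.
have ei : iter d shift (shift M) i = shift (iter d shift M) i by rewrite e.
have eqi : (eqhom e : fhom _ _) i = eqhom ei.
  by move: ei; clear he; destruct e => ei /=; rewrite eqhom1.
have hi : eqhom ei \oc pw (fmor shift f) d i
    = fmor (twist C (i.+1 < d)%N) (pw f d (ordS i)).
  by rewrite -eqi; exact: (congr1 (fun k : fhom _ _ => k i) he).
have tw b (X : C) : twist C b (S X) = S (twist C b X) by case: b.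
have tweta b (X : C) :
    eqhom (tw b X) \oc fmor (twist C b) (eta X) = eta (twist C b X).
  case: b (tw b X) => /= e0; rewrite eqhom1 cmp1m //.
  by rewrite eta_susp.
rewrite -[RHS]tweta -(ff (ordS i)) fmorM -hi !cmpA; congr (_ \oc _).
have e1 : twist C (i.+1 < d)%N (iter d shift M (ordS i))
    = twist C (i.+1 < d)%N (S (M (ordS i))) by rewrite iter_shift.
rewrite (eqhom_fmor _ e1).
have e0 : twist C (i.+1 < d)%N (iter d shift M (ordS i)) = S (shift M i).
  by rewrite e1 tw.
rewrite (eqhomM e1 (tw _ _) e0).
exact/esym/eqhomM.
Qed.

Lemma factorizes_opp M (f : hom M (shift M)) : factorizes f -> factorizes (- f).
Proof.
move=> ff i; rewrite -(ff i); congr (_ \oc _).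
by rewrite pw_opp.
Qed.

Definition Sigma_ob (M : FactCat) : FactCat :=
  Factorization (factorizes_opp (factorizes_shift (@fa_factorizes M))).

Fact Sigma_comm (M N : FactCat) (f : hom M N) :
  fmor shift (fmor shift (fh_val f)) \oc fa_mor (Sigma_ob M)
  = fa_mor (Sigma_ob N) \oc fmor shift (fh_val f).
Proof. by rewrite cmpmN cmpNm -!fmorM fh_comm. Qed.

Definition Sigma_mor (M N : FactCat) (f : hom M N) :
  hom (Sigma_ob M) (Sigma_ob N) :=
  @FactHom (Sigma_ob M) (Sigma_ob N) _ (Sigma_comm f).

Fact Sigma1 (M : FactCat) : Sigma_mor (idm M) = idm (Sigma_ob M).
Proof. by apply: fact_hom_eq; exact: fmor1. Qed.
Fact SigmaM (M N P : FactCat) (g : hom N P) (f : hom M N) :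
  Sigma_mor (g \oc f) = Sigma_mor g \oc Sigma_mor f.
Proof. by apply: fact_hom_eq; exact: fmorM. Qed.
Fact SigmaD (M N : FactCat) (f f' : hom M N) :
  Sigma_mor (f + f') = Sigma_mor f + Sigma_mor f'.
Proof. by apply: fact_hom_eq; exact: fmorD. Qed.

Definition SigmaFact : addFun FactCat FactCat := AddFun Sigma1 SigmaM SigmaD.

Fact Sigma_null (M N : FactCat) (f : hom M N) :
  idl null_ideal f -> idl null_ideal (fmor SigmaFact f).
Proof.
move=> /homotopicP[s es]; apply/homotopicP; exists (- fmor shift s).
rewrite subr0 in es.
have h : fmor shift (fmor shift (fh_val f))
    = fmor shift (- fmor shift s \oc - fmor shift (fa_mor M))
      + - fmor shift (fa_mor N) \oc - fmor shift s.
  by rewrite es fmorD cmpNm cmpmN opprK cmpNm cmpmN opprK -!fmorM.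
by rewrite subr0; exact: h.
Qed.

Definition SigmaH : addFun HFactCat HFactCat :=
  quot_lift Sigma_null.

Section Cone.
Variables (M N : FactCat) (f : hom M N).
Local Notation TM := (shift (fa_ob M) : famCat).
Local Notation NN := (fa_ob N).

(* The matrix [-f_(i+1), 0; phi_(i+1), g_i]; in the last component, S (in1)
   and S (in2) identify S (M_2 + N_1) with S M_2 + S N_1. *)
Definition cone_mor : hom (bip TM NN) (shift (bip TM NN)) :=
  fmor shift (in1 TM NN) \oc (- fmor shift (fa_mor M)) \oc pr1 TM NN
  + fmor shift (in2 TM NN)
    \oc (fmor shift (fh_val f) \oc pr1 TM NN + fa_mor N \oc pr2 TM NN).

Fact cone_in1 : cone_mor \oc in1 TM NN
  = fmor shift (in1 TM NN) \oc (- fmor shift (fa_mor M))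
    + fmor shift (in2 TM NN) \oc fmor shift (fh_val f).
Proof.
rewrite cmpDl -cmpA pr1in1 cmpm1 -cmpA cmpDl -!cmpA pr1in1 pr2in1.
by rewrite cmpm1 cmpm0 addr0.
Qed.

Fact cone_in2 :
  fmor shift (in2 TM NN) \oc fa_mor N = cone_mor \oc in2 TM NN.
Proof.
rewrite cmpDl -cmpA pr1in2 cmpm0 add0r -cmpA cmpDl -!cmpA pr1in2 pr2in2.
by rewrite cmpm1 cmpm0 add0r.
Qed.

Fact cone_factorizes : factorizes cone_mor.
Proof.
apply: (factorizes_cover (@fa_factorizes (Sigma_ob M)) (@fa_factorizes N) _ _
  (bipE TM NN)).
  apply: pw_mor2 => //; rewrite -cmpA cone_in1 cmpDr !cmpA -!fmorM.
  rewrite cone_in1 -cone_in2 fmorD cmpDl !fmorM -addrA.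
  have h : fmor shift (fmor shift (fh_val f)) \oc (- fmor shift (fa_mor M))
      + fmor shift (fa_mor N) \oc fmor shift (fh_val f) = 0.
    by rewrite cmpmN -!fmorM fh_comm addNr.
  rewrite -!(cmpA (fmor shift (fmor shift (in2 TM NN)))) -cmpDr h cmpm0.
  by rewrite addr0.
by apply: pw_mor; exact: cone_in2.
Qed.

Definition cone : FactCat := Factorization cone_factorizes.

Definition cone_in : hom N cone := @FactHom N cone (in2 TM NN) cone_in2.

Fact cone_pr_comm :
  fmor shift (pr1 TM NN) \oc cone_mor = fa_mor (Sigma_ob M) \oc pr1 TM NN.
Proof.
by rewrite cmpDr !cmpA -!fmorM pr1in1 pr1in2 fmor1 fmor0 cmp1m !cmp0m addr0.
Qed.

Definition cone_pr : hom cone (SigmaFact M) :=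
  @FactHom cone (Sigma_ob M) (pr1 TM NN) cone_pr_comm.

Definition standard_triangle : triangle SigmaH :=
  @Triangle HFactCat SigmaH M N cone (hcls f) (hcls cone_in) (hcls cone_pr).

End Cone.

Definition HFact_tri : triData :=
  @TriData HFactCat SigmaH
    (fun t => exists (M N : FactCat) (f : hom M N),
       tri_iso (standard_triangle f) t).

End Factorizations.

(* Main.v *)
From mathcomp Require Import all_boot ssralg boolp.
Require Import Defs.

Set Implicit Arguments.
Unset Strict Implicit.
Unset Printing Implicit Defensive.

Import GRing.Theory.
Local Open Scope ring_scope.
Local Open Scope cat_scope.

(** Write [T] for the cyclic shift of families of objects, so that a
    factorization is a family [M] with a map [f : M -> T M], and let
    [W = (T f) f : M -> T^2 M].  As [d] is even, the condition on the [d]-fold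
    composites of [f] is a condition on the powers of [W] alone.  Moreover a
    family of maps [s : T M -> N] is a homotopy between some two morphisms if
    and only if it commutes with [W] ([homotopy_hom], [homotopy_sqr_comm]).  A
    factorization thus behaves like a complex over the category of pairs
    [(M, W)], with translation [T] and differential [f], except that the
    differential squares to the natural map [W] instead of zero.  The obstruction
    to [s f + f s] being a morphism is the difference of [W s] and [s W], so the
    classical arguments for complexes go through.

    Triangulation.  Morphisms out of a mapping cone are pairs of a morphism and
    a null-homotopy ([cone_copair]), so homotopy commutative squares extend to
    mapping cones ([cone_map_ex]).  Rotation amounts to a homotopy equivalence
    of [cone (cone_in f)] with [Sigma M] ([cone_cone_in]), the octahedral axiom
    to one of the cone of [cone f -> cone (g f)] with [cone g]
    ([cone_octahedron]).  That a triangle is distinguished as soon as its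
    rotation is, and that the octahedral axiom only needs to be checked on
    standard triangles, follows formally from the other axioms
    ([dist_rot_inv], [octahedron_transfer]).

    Algebraicity.  The sequences of factorizations that split by maps
    commuting with [W] form an exact structure; up to isomorphism they are the
    sequences [N -> cone f -> Sigma M] ([conf_coneP]), from which
    pushouts, pullbacks and composites can be read off.  The projective and the
    injective objects are both the contractible ones, and the mapping cones of
    identities supply enough of them, so this is a Frobenius category.  The
    morphisms that vanish in its stable category are the null-homotopic ones
    ([stably_zeroP]).  With the hulls [M -> cone (idm M) -> Sigma M], the
    pushout of the hull along [f] is [cone f] ([cone_pushout]), so the identity
    functor carries standard triangles to standard triangles. *)

(** * Isomorphisms and triangles *)

Section IsoTheory.
Variable C : preaddCat.
Implicit Types X Y Z : C.

Lemma is_iso_id X : is_iso (idm X).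
Proof. by exists (idm X); rewrite cmp1m. Qed.

Lemma is_iso_cmp X Y Z (g : hom Y Z) (f : hom X Y) :
  is_iso g -> is_iso f -> is_iso (g \oc f).
Proof.
move=> [g' [g'g gg']] [f' [f'f ff']]; exists (f' \oc g'); split.
  by rewrite cmpA -(cmpA f') g'g cmpm1.
by rewrite cmpA -(cmpA g) ff' cmpm1.
Qed.

Lemma is_iso_fmor (D : preaddCat) (F : addFun C D) X Y (f : hom X Y) :
  is_iso f -> is_iso (fmor F f).
Proof.
by move=> [g [gf fg]]; exists (fmor F g); rewrite -!fmorM gf fg !fmor1.
Qed.

Lemma is_iso_fmor_inv (D : preaddCat) (F : addFun C D) X Y (f : hom X Y) :
  fully_faithful F -> is_iso (fmor F f) -> is_iso f.
Proof.
move=> Fff [k [kf fk]]; have [g eg] := fmor_surj Fff k; exists g.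
by split; apply: (fmor_inj Fff); rewrite fmorM fmor1 eg.
Qed.

Lemma is_iso_two_sided X Y (f : hom X Y) (g g' : hom Y X) :
  is_iso (g \oc f) -> is_iso (f \oc g') -> is_iso f.
Proof.
move=> [k [kgf _]] [k' [_ fgk']].
rewrite cmpA in kgf; rewrite -cmpA in fgk'.
exists (k \oc g); split => //.
by rewrite -[k \oc g]cmpm1 -fgk' (cmpA (k \oc g)) kgf cmp1m.
Qed.

(** The inverse is [2 - e], as [(e - 1)^2 = 0]. *)
Lemma is_iso_unipotent X (e : hom X X) :
  (e - idm X) \oc (e - idm X) = 0 -> is_iso e.
Proof.
move=> n0; rewrite -[e](subrK (idm X)) addrC; move: (e - idm X) n0 => n n0.
exists (idm X - n); split.
  by rewrite cmpBl !cmpDr !cmp1m cmpm1 n0 addr0 addrK.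
by rewrite cmpBr !cmpDl !cmpm1 cmp1m n0 addr0 addrK.
Qed.

(** Multiply the decomposition of [idm Y] by [p] and [i], resp. by [r] and
    [s]. *)
Lemma split_orthogonal X Y Z (i : hom X Y) (p : hom Y Z) (r : hom Y X)
    (s : hom Z Y) :
  r \oc i = idm X -> p \oc s = idm Z -> i \oc r + s \oc p = idm Y ->
  p \oc i = 0 /\ r \oc s = 0.
Proof.
move=> ri ps e; split.
  apply: (@addrI _ (p \oc i)); rewrite addr0 -{3}[i]cmp1m -e cmpDl cmpDr.
  by rewrite -!cmpA ri cmpm1 (cmpA p s) ps cmp1m.
apply: (@addrI _ (r \oc s)); rewrite addr0 -{3}[s]cmp1m -e cmpDl cmpDr.
by rewrite -!cmpA ps cmpm1 (cmpA r i) ri cmp1m.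
Qed.

End IsoTheory.

Section TriIso.
Variables (C : preaddCat) (Sg : addFun C C).

Lemma tri_iso_refl (t : triangle Sg) : tri_iso t t.
Proof.
exists (idm _), (idm _), (idm _); split; first by split; exact: is_iso_id.
by rewrite fmor1 !cmp1m !cmpm1.
Qed.

Lemma tri_iso_trans (t1 t2 t3 : triangle Sg) :
  tri_iso t1 t2 -> tri_iso t2 t3 -> tri_iso t1 t3.
Proof.
move=> [a [b [c [[ia ib ic] [e1 e2 e3]]]]].
move=> [a' [b' [c' [[ia' ib' ic'] [e1' e2' e3']]]]].
exists (a' \oc a), (b' \oc b), (c' \oc c); split; first by split; exact: is_iso_cmp.
by rewrite fmorM -!cmpA e1 e2 e3 !cmpA e1' e2' e3'.
Qed.

Lemma tri_iso_rot (X Y Z X' Y' Z' : C) (u : hom X Y) (v : hom Y Z)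
    (w : hom Z (Sg X)) (u' : hom X' Y') (v' : hom Y' Z') (w' : hom Z' (Sg X')) :
  tri_iso (Triangle u v w) (Triangle u' v' w') ->
  tri_iso (Triangle v w (- fmor Sg u)) (Triangle v' w' (- fmor Sg u')).
Proof.
move=> [/= a [b [c [[ia ib ic] [e1 e2 e3]]]]].
exists b, c, (fmor Sg a); split=> /=.
  by split=> //; exact: is_iso_fmor.
by split=> //; rewrite cmpmN cmpNm -!fmorM e1.
Qed.

(** The morphism axiom for the given pair of triangles. *)
Definition tri_extends (t t' : triangle Sg) : Prop :=
  forall (a : hom (tX t) (tX t')) (b : hom (tY t) (tY t')),
  b \oc tu t = tu t' \oc a ->
  exists c : hom (tZ t) (tZ t'),
    c \oc tv t = tv t' \oc b /\ fmor Sg a \oc tw t = tw t' \oc c.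

Lemma tri_extends_iso (s t s' t' : triangle Sg) :
  tri_iso s t -> tri_iso s' t' -> tri_extends s s' -> tri_extends t t'.
Proof.
move=> [xa [xb [xc [[ixa ixb ixc] [x1 x2 x3]]]]].
move=> [ya [yb [yc [[iya iyb iyc] [y1 y2 y3]]]]] ext a b e.
have [xb' [_ xbK]] := ixb; have [xc' [xcK xcK']] := ixc.
have [ya' [yaK yaK']] := iya; have [yb' [ybK ybK']] := iyb.
have [|c [c1 c2]] := ext (ya' \oc (a \oc xa)) (yb' \oc (b \oc xb)).
  rewrite -!cmpA x1 (cmpA b) e -!cmpA !(cmpA _ ya') !cmpA; congr (_ \oc _ \oc _).
  by rewrite -[LHS]cmpm1 -yaK' -!cmpA (cmpA (tu t')) -y1 !cmpA ybK cmp1m.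
exists (yc \oc (c \oc xc')); split.
  rewrite -!cmpA -[tv t]cmpm1 -xbK (cmpA (tv t)) -x2 !(cmpA xc') xcK cmp1m.
  rewrite (cmpA c) c1 !cmpA y2 -(cmpA _ yb) ybK' cmpm1 -!cmpA.
  by rewrite xbK cmpm1.
rewrite !cmpA -y3 -(cmpA _ _ c) -c2 -!cmpA -[tw t]cmpm1 -xcK'.
by rewrite (cmpA (tw t)) -x3 !cmpA -!fmorM !cmpA yaK' cmp1m.
Qed.

End TriIso.

Lemma tri_image_iso (D E : triData) (F : addFun D E)
    (th : forall X, hom (F (td_susp D X)) (td_susp E (F X)))
    (t t' : triangle (td_susp D)) :
  (forall X Y (f : hom X Y), fmor (td_susp E) (fmor F f) \oc th X
     = th Y \oc fmor F (fmor (td_susp D) f)) ->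
  tri_iso t t' -> tri_iso (tri_image th t) (tri_image th t').
Proof.
move=> th_nat [a [b [c [[ia ib ic] [e1 e2 e3]]]]].
exists (fmor F a), (fmor F b), (fmor F c); split.
  by split; exact: is_iso_fmor.
split=> /=; rewrite -?fmorM ?e1 ?e2 //.
by rewrite cmpA th_nat -!cmpA -!fmorM e3.
Qed.

(** * Consequences of a part of the axioms of a triangulated category *)

Section Pretriangulated.
Variable D : triData.
Local Notation Sg := (td_susp D).
Local Notation dist u v w := (td_dist D (Triangle u v w)).
Hypothesis Daut : is_automorphism Sg.
Hypothesis Diso : forall t t', tri_iso t t' -> td_dist D t -> td_dist D t'.
Hypothesis Did : forall X : D, td_dist D (@Triangle D Sg X X zob (idm X) 0 0).
Hypothesis Dext : forall (X Y : D) (u : hom X Y),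
    exists (Z : D) (v : hom Y Z) (w : hom Z (Sg X)), dist u v w.
Hypothesis Drot : forall (X Y Z : D) (u : hom X Y) (v : hom Y Z)
    (w : hom Z (Sg X)), dist u v w -> dist v w (- fmor Sg u).
Hypothesis Dmor : forall t t', td_dist D t -> td_dist D t' ->
    forall (a : hom (tX t) (tX t')) (b : hom (tY t) (tY t')),
    b \oc tu t = tu t' \oc a ->
    exists c : hom (tZ t) (tZ t'),
      c \oc tv t = tv t' \oc b /\ fmor Sg a \oc tw t = tw t' \oc c.

Let Sff := Daut.2.

(** A morphism [g] with [v g = 0] gives a morphism from the rotation of the
    trivial triangle on its source to the rotation of the given triangle; the
    third component is the suspension of the required factor. *)
Lemma dist_weak_kernel (X Y Z W : D) (u : hom X Y) (v : hom Y Z)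
    (w : hom Z (Sg X)) (g : hom W Y) :
  dist u v w -> v \oc g = 0 -> exists h : hom W X, g = u \oc h.
Proof.
move=> uvw vg0.
have [|c [_ /= ec]] := Dmor (Drot (Did W)) (Drot uvw) (a := g) (b := 0).
  by rewrite /= vg0 cmp0m.
have [h eh] := fmor_surj Sff c; exists h; apply: (fmor_inj Sff).
move: ec; rewrite fmor1 cmpmN cmpm1 cmpNm => /oppr_inj ->.
by rewrite fmorM eh.
Qed.

(** The difference [e - 1] vanishes on [v] and is killed by [w]; by the second
    property it factors through [v], so its square is zero. *)
Lemma dist_endo_iso (X Y Z : D) (u : hom X Y) (v : hom Y Z)
    (w : hom Z (Sg X)) (e : hom Z Z) :
  dist u v w -> e \oc v = v -> w \oc e = w -> is_iso e.
Proof.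
move=> uvw ev we.
have [|y ey] := dist_weak_kernel (g := e - idm Z) (Drot uvw).
  by rewrite cmpBr we cmpm1 subrr.
by apply: is_iso_unipotent; rewrite {2}ey cmpA cmpBl ev cmp1m subrr cmp0m.
Qed.

(** Comparison morphisms exist in both directions, and each of the two
    composites is invertible by [dist_endo_iso]. *)
Lemma dist_unique (X Y Z Z' : D) (u : hom X Y)
    (v : hom Y Z) (w : hom Z (Sg X)) (v' : hom Y Z') (w' : hom Z' (Sg X)) :
  dist u v w -> dist u v' w' ->
  exists2 c : hom Z Z', is_iso c & c \oc v = v' /\ w' \oc c = w.
Proof.
move=> uvw uvw'.
have [|c /= [cv cw]] := Dmor uvw uvw' (a := idm X) (b := idm Y).
  by rewrite /= cmp1m cmpm1.
have [|c' /= [cv' cw']] := Dmor uvw' uvw (a := idm X) (b := idm Y).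
  by rewrite /= cmp1m cmpm1.
rewrite fmor1 cmp1m cmpm1 in cv cw; rewrite fmor1 cmp1m cmpm1 in cv' cw'.
exists c; last by [].
apply: (is_iso_two_sided (g := c') (g' := c')).
- by apply: (dist_endo_iso uvw); rewrite -?cmpA ?cv // cmpA -cw' -cw.
- by apply: (dist_endo_iso uvw'); rewrite -?cmpA ?cv' // cmpA -cw -cw'.
Qed.

(** Rotating [v, w, - Sg u] twice gives the suspension of [u, v, w] up to
    signs, as does rotating three times a distinguished triangle on [u].  The
    two are isomorphic, and the isomorphism is a suspension. *)
Lemma dist_rot_inv (X Y Z : D) (u : hom X Y) (v : hom Y Z) (w : hom Z (Sg X)) :
  dist v w (- fmor Sg u) -> dist u v w.
Proof.
move=> /Drot/Drot uvw; have [Z' [v' [w' uvw']]] := Dext u.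
have [c0 ic0 [cv cw]] := dist_unique (Drot (Drot (Drot uvw'))) uvw.
have [c ec] := fmor_surj Sff c0; subst c0.
apply: (Diso _ uvw'); exists (idm X), (idm Y), c; split.
  by split; [exact: is_iso_id | exact: is_iso_id | exact: is_iso_fmor_inv ic0].
rewrite /= fmor1 !cmp1m !cmpm1; split => //; apply: (fmor_inj Sff).
  by apply: oppr_inj; rewrite -cv fmorM cmpmN.
by apply: oppr_inj; rewrite fmorM -cmpNm cw.
Qed.

(** Distinguished triangles on given morphisms are unique up to isomorphism,
    so an octahedron on one choice of the three triangles can be transported to
    any other choice. *)
Lemma octahedron_transfer (X Y Z : D) (u : hom X Y) (v : hom Y Z)
    (A0 B0 C0 A1 B1 C1 : D)
    (i0 : hom Y A0) (i0' : hom A0 (Sg X)) (j0 : hom Z B0) (j0' : hom B0 (Sg Y))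
    (k0 : hom Z C0) (k0' : hom C0 (Sg X)) (i : hom Y A1) (i' : hom A1 (Sg X))
    (j : hom Z B1) (j' : hom B1 (Sg Y)) (k : hom Z C1) (k' : hom C1 (Sg X)) :
  dist u i0 i0' -> dist v j0 j0' -> dist (v \oc u) k0 k0' ->
  dist u i i' -> dist v j j' -> dist (v \oc u) k k' ->
  (exists (f : hom A0 C0) (g : hom C0 B0),
      dist f g (fmor Sg i0 \oc j0') /\
      [/\ f \oc i0 = k0 \oc v, k0' \oc f = i0', g \oc k0 = j0
        & j0' \oc g = fmor Sg u \oc k0']) ->
  exists (f : hom A1 C1) (g : hom C1 B1),
      dist f g (fmor Sg i \oc j') /\
      [/\ f \oc i = k \oc v, k' \oc f = i', g \oc k = j
        & j' \oc g = fmor Sg u \oc k'].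
Proof.
move=> du0 dv0 dvu0 du dv dvu [f [g [dfg [e1 e2 e3 e4]]]].
have [a ia [ai ai']] := dist_unique du0 du.
have [b ib [bj bj']] := dist_unique dv0 dv.
have [c ic [ck ck']] := dist_unique dvu0 dvu.
have [a' [a'a aa']] := ia; have [c' [c'c cc']] := ic.
exists (c \oc f \oc a'), (b \oc g \oc c'); split.
  apply: (Diso _ dfg); exists a, c, b; split=> //=; split.
  - by rewrite -!cmpA a'a cmpm1.
  - by rewrite -!cmpA c'c cmpm1.
  - by rewrite cmpA -fmorM ai -bj' cmpA.
split.
- by rewrite -ai -!cmpA (cmpA a') a'a cmp1m e1 cmpA ck.
- by rewrite 2!cmpA ck' e2 -ai' -cmpA aa' cmpm1.
- by rewrite -ck -!cmpA (cmpA c') c'c cmp1m e3.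
- by rewrite !cmpA bj' e4 -ck' -!cmpA cc' cmpm1.
Qed.

End Pretriangulated.

(** * Factorizations as curved complexes *)

Section FactTheory.
Variables (C : suspCat) (d : nat) (eta : suspNat C).
Hypothesis d_even : ~~ odd d.
Local Notation Fam := (famCat C d).
Local Notation T := (@shift C d).
Local Notation FC := (FactCat d eta).
Local Notation Sig := (SigmaFact eta d_even).
Local Notation cone := (cone d_even).
Implicit Types M N P Q : FC.

Lemma fh_cmp M N P (g : hom N P) (f : hom M N) :
  fh_val (g \oc f) = fh_val g \oc fh_val f.
Proof. by []. Qed.

Lemma fh_add M N (f g : hom M N) : fh_val (f + g) = fh_val f + fh_val g.
Proof. by []. Qed.

Lemma fh_opp M N (f : hom M N) : fh_val (- f) = - fh_val f.
Proof. by []. Qed.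

Lemma fh_zero M N : fh_val (0 : hom M N) = 0.
Proof. by []. Qed.

Lemma fh_idm M : fh_val (idm M) = idm (M : Fam).
Proof. by []. Qed.

Definition fhE := (fh_cmp, fh_add, fh_opp, fh_zero, fh_idm).

Lemma fh_Sigma M N (f : hom M N) : fh_val (fmor Sig f) = fmor T (fh_val f).
Proof. by []. Qed.

(** The structure map, as a differential.  It is sealed, so that rewriting
    cannot unfold the matrix of a mapping cone. *)
Definition dd M : hom (M : Fam) (T (M : Fam)) := locked (fa_mor M).

Lemma ddE M : fa_mor M = dd M.
Proof. by rewrite /dd -lock. Qed.

Lemma dd_comm M N (f : hom M N) :
  fmor T (fh_val f) \oc dd M = dd N \oc fh_val f.
Proof. by rewrite -!ddE fh_comm. Qed.

Lemma fact_hom_of M N (h : hom (M : Fam) (N : Fam)) :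
  fmor T h \oc dd M = dd N \oc h -> exists f : hom M N, fh_val f = h.
Proof. by rewrite -!ddE => ch; exists (FactHom ch). Qed.

Lemma dd_Sigma M : dd (Sig M) = - fmor T (dd M).
Proof. by rewrite -!ddE. Qed.

Lemma T_inj (X Y : Fam) (f g : hom X Y) : fmor T f = fmor T g -> f = g.
Proof. exact: fmor_inj (@shift_ff C d) _ _ _ _. Qed.

Lemma T_surj (X Y : Fam) (h : hom (T X) (T Y)) : exists f, fmor T f = h.
Proof. exact: fmor_surj (@shift_ff C d) _ _ h. Qed.

(** The curvature, sealed for the same reason. *)
Definition sqr M : hom (M : Fam) (T (T (M : Fam))) :=
  locked (fmor T (dd M) \oc dd M).

Lemma sqrE M : sqr M = fmor T (dd M) \oc dd M.
Proof. by rewrite /sqr -lock. Qed.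

Definition sqr_comm M N (h : hom (M : Fam) (N : Fam)) : Prop :=
  fmor T (fmor T h) \oc sqr M = sqr N \oc h.

Lemma sqr_Sigma M : sqr (Sig M) = fmor T (sqr M).
Proof.
by rewrite !sqrE !dd_Sigma fmorN cmpNm cmpmN opprK -fmorM.
Qed.

Lemma sqr_comm_hom M N (f : hom M N) : sqr_comm (fh_val f).
Proof.
rewrite /sqr_comm !sqrE cmpA -fmorM dd_comm fmorM -!cmpA; congr (_ \oc _).
exact: dd_comm.
Qed.

Lemma sqr_comm_cmp M N P (g : hom (N : Fam) (P : Fam))
    (f : hom (M : Fam) (N : Fam)) :
  sqr_comm g -> sqr_comm f -> sqr_comm (g \oc f).
Proof. by rewrite /sqr_comm => cg cf; rewrite !fmorM -cmpA cf cmpA cg cmpA. Qed.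

Lemma sqr_comm_add M N (f g : hom (M : Fam) (N : Fam)) :
  sqr_comm f -> sqr_comm g -> sqr_comm (f + g).
Proof. by rewrite /sqr_comm => cg cf; rewrite !fmorD cmpDl cmpDr cf cg. Qed.

Lemma sqr_comm0 M N : sqr_comm (0 : hom (M : Fam) (N : Fam)).
Proof. by rewrite /sqr_comm !fmor0 cmp0m cmpm0. Qed.

Lemma sqr_comm_T M N (h : hom (M : Fam) (N : Fam)) :
  sqr_comm (M := Sig M) (N := Sig N) (fmor T h) <-> sqr_comm h.
Proof.
rewrite /sqr_comm !sqr_Sigma; split=> [e|e]; last by rewrite -!fmorM e.
by apply: T_inj; rewrite !fmorM.
Qed.

(** If [s] commutes with the curvature, then the two outer terms of the
    compatibility condition for [s f + f s], which contain the squares of the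
    differentials, agree; the two inner terms always do. *)
Lemma homotopy_hom M N (s : hom (T (M : Fam)) (N : Fam)) :
  sqr_comm (M := Sig M) s ->
  exists h : hom M N, fmor T (fh_val h) = fmor T (s \oc dd M) + dd N \oc s.
Proof.
rewrite /sqr_comm sqr_Sigma => cs.
have [h eh] := T_surj (fmor T (s \oc dd M) + dd N \oc s).
have [|h' eh'] := @fact_hom_of M N h; last by exists h'; rewrite eh'.
apply: T_inj; rewrite !fmorM eh fmorD !cmpDl !cmpDr addrC; congr (_ + _).
  by rewrite !fmorM -!cmpA.
rewrite cmpA -sqrE -cs !sqrE !fmorM -!cmpA.
by rewrite !cmpA.
Qed.

(** The converse of the computation in [homotopy_hom]. *)
Lemma homotopy_sqr_comm M N (h : hom M N) (s : hom (T (M : Fam)) (N : Fam)) :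
  fmor T (fh_val h) = fmor T (s \oc dd M) + dd N \oc s ->
  sqr_comm (M := Sig M) s.
Proof.
move=> eh; rewrite /sqr_comm sqr_Sigma.
have := congr1 (fmor T) (dd_comm h).
rewrite !fmorM eh fmorD !cmpDl !cmpDr !fmorM -!cmpA addrC.
by move=> /addrI; rewrite !sqrE !fmorM -!cmpA.
Qed.

Lemma nullP M N (h : hom M N) :
  null_homotopic h <-> exists s : hom (T (M : Fam)) (N : Fam),
    fmor T (fh_val h) = fmor T (s \oc dd M) + dd N \oc s.
Proof.
rewrite -!ddE; split=> [/homotopicP|] [s es]; [|apply/homotopicP]; exists s.
  by rewrite -es subr0.
by rewrite subr0.
Qed.

Lemma hclsE M N (f g : hom M N) :
  hcls f = hcls g <-> exists s : hom (T (M : Fam)) (N : Fam),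
    fmor T (fh_val f) = fmor T (fh_val g) + (fmor T (s \oc dd M) + dd N \oc s).
Proof.
rewrite hclsP -!ddE; split=> [/homotopicP|] [s es]; [|apply/homotopicP]; exists s.
  by rewrite -es fmorB addrC subrK.
by rewrite fmorB es addrC addKr.
Qed.

(** * Morphisms from and to mapping cones *)

Section Cone.
Variables (M N : FC) (f : hom M N).
Local Notation TM := (shift (fa_ob M) : Fam).
Local Notation NN := (fa_ob N).

Definition ci : hom TM (cone f : Fam) := in1 TM NN.
Definition cj : hom (N : Fam) (cone f : Fam) := in2 TM NN.
Definition cp : hom (cone f : Fam) TM := pr1 TM NN.
Definition cq : hom (cone f : Fam) (N : Fam) := pr2 TM NN.

Lemma fh_cone_in : fh_val (cone_in d_even f) = cj. Proof. by []. Qed.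
Lemma fh_cone_pr : fh_val (cone_pr d_even f) = cp. Proof. by []. Qed.
Lemma cp_ci : cp \oc ci = idm TM. Proof. exact: pr1in1. Qed.
Lemma cp_cj : cp \oc cj = 0. Proof. exact: pr1in2. Qed.
Lemma cq_ci : cq \oc ci = 0. Proof. exact: pr2in1. Qed.
Lemma cq_cj : cq \oc cj = idm (N : Fam). Proof. exact: pr2in2. Qed.
Lemma cone_idm : ci \oc cp + cj \oc cq = idm (cone f : Fam).
Proof. exact: bipE. Qed.

Lemma dd_cone_ci : dd (cone f) \oc ci
  = fmor T cj \oc fmor T (fh_val f) - fmor T ci \oc fmor T (dd M).
Proof. by rewrite addrC -cmpmN -!ddE; exact: cone_in1. Qed.

Lemma dd_cone_cj : dd (cone f) \oc cj = fmor T cj \oc dd N.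
Proof. by rewrite -!ddE; exact/esym/cone_in2. Qed.

Lemma cone_ext (X : Fam) (g g' : hom (cone f : Fam) X) :
  g \oc ci = g' \oc ci -> g \oc cj = g' \oc cj -> g = g'.
Proof.
by move=> ei ej; rewrite -[g]cmpm1 -[g']cmpm1 -cone_idm !cmpDr !cmpA ei ej.
Qed.

Lemma cone_coext (X : Fam) (g g' : hom X (cone f : Fam)) :
  cp \oc g = cp \oc g' -> cq \oc g = cq \oc g' -> g = g'.
Proof.
by move=> ei ej; rewrite -[g]cmp1m -[g']cmp1m -cone_idm !cmpDl -!cmpA ei ej.
Qed.

(** The off-diagonal entry of the square of the matrix of the cone is
    [(T f_N) (T phi) - (T^2 phi) (T f_M) = 0], so the curvature of a cone is the
    sum of the curvatures of its summands. *)
Lemma sqr_comm_ci : sqr_comm (M := Sig M) ci.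
Proof.
rewrite /sqr_comm sqr_Sigma !sqrE -(cmpA (fmor T (dd (cone f)))) dd_cone_ci.
rewrite cmpBr !cmpA -!fmorM dd_cone_cj dd_cone_ci cmpBl fmorB.
rewrite -(cmpA _ _ (dd M)) -(cmpA _ (dd N)) dd_comm !fmorM opprB addrC subrK.
by rewrite !cmpA.
Qed.

Lemma sqr_comm_cj : sqr_comm cj.
Proof. exact: sqr_comm_hom (cone_in d_even f). Qed.

Lemma sqr_comm_cp : sqr_comm (N := Sig M) cp.
Proof. exact: sqr_comm_hom (cone_pr d_even f). Qed.

Lemma sqr_comm_cq : sqr_comm cq.
Proof.
apply: cone_ext.
  rewrite -!cmpA -sqr_comm_ci cq_ci cmpm0 cmpA -!fmorM.
  by rewrite cq_ci !fmor0 cmp0m.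
rewrite -!cmpA -sqr_comm_cj cq_cj cmpm1 cmpA -!fmorM.
by rewrite cq_cj !fmor1 cmp1m.
Qed.

(** The hypothesis is that [t] is a null-homotopy of [b f]. *)
Lemma cone_copair Q (b : hom N Q) (t : hom TM (Q : Fam)) :
  fmor T (fh_val b \oc fh_val f) = fmor T (t \oc dd M) + dd Q \oc t ->
  exists h : hom (cone f) Q, fh_val h \oc ci = t /\ fh_val h \oc cj = fh_val b.
Proof.
move=> e; pose h := t \oc cp + fh_val b \oc cq.
have hi : h \oc ci = t by rewrite cmpDl -!cmpA cp_ci cq_ci cmpm1 cmpm0 addr0.
have hj : h \oc cj = fh_val b.
  by rewrite cmpDl -!cmpA cp_cj cq_cj cmpm1 cmpm0 add0r.
have [|h' eh'] := @fact_hom_of (cone f) Q h; last by exists h'; rewrite eh'.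
apply: cone_ext.
  rewrite -!cmpA hi dd_cone_ci cmpBr !cmpA -!fmorM hi hj e.
  by rewrite fmorM addrC addKr.
by rewrite -!cmpA hj dd_cone_cj cmpA -fmorM hj dd_comm.
Qed.

End Cone.

(** A homotopy [s] in the square of [a] and [b] enters as the off-diagonal
    entry. *)
Lemma cone_map_ex M N M' N' (f : hom M N) (f' : hom M' N')
    (a : hom M M') (b : hom N N') (s : hom (T (M : Fam)) (N' : Fam)) :
  fmor T (fh_val (b \oc f)) = fmor T (fh_val (f' \oc a))
    + (fmor T (s \oc dd M) + dd N' \oc s) ->
  exists h : hom (cone f) (cone f'),
    fh_val h \oc ci f = ci f' \oc fmor T (fh_val a) + cj f' \oc s
    /\ fh_val h \oc cj f = cj f' \oc fh_val b.
Proof.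
move=> e.
have [|h [hi hj]] := @cone_copair _ _ f (cone f') (cone_in d_even f' \oc b)
    (ci f' \oc fmor T (fh_val a) + cj f' \oc s); last by exists h.
rewrite !fhE fh_cone_in -cmpA fmorM -fh_cmp e.
rewrite !fhE !cmpDl !cmpDr fmorD !cmpA.
rewrite dd_cone_ci dd_cone_cj cmpBl !fmorM -!cmpA.
rewrite -[X in fmor T (ci f') \oc X]fmorM dd_comm fmorM.
rewrite [RHS]addrACA; congr (_ + _).
by rewrite addrC subrK.
Qed.

Lemma cone_extT M N (f : hom M N) (X : Fam) (g g' : hom (T (cone f : Fam)) X) :
  g \oc fmor T (ci f) = g' \oc fmor T (ci f) ->
  g \oc fmor T (cj f) = g' \oc fmor T (cj f) -> g = g'.
Proof.
move=> ei ej; rewrite -[g]cmpm1 -[g']cmpm1 -fmor1 -cone_idm fmorD !fmorM.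
by rewrite !cmpDr !cmpA ei ej.
Qed.

(** An equation between composites, in the forms in which it meets composites
    associated to the right: followed by a further morphism, and after one or
    two applications of the shift functor. *)
Lemma cmp_rules (X Y Z : Fam) (a : hom Y Z) (b : hom X Y) (c : hom X Z) :
  a \oc b = c ->
  (a \oc b = c) * (forall W (x : hom W X), a \oc (b \oc x) = c \oc x) *
  (fmor T a \oc fmor T b = fmor T c) *
  (forall W (x : hom W (T X)),
     fmor T a \oc (fmor T b \oc x) = fmor T c \oc x) *
  (fmor T (fmor T a) \oc fmor T (fmor T b) = fmor T (fmor T c)) *
  (forall W (x : hom W (T (T X))),
     fmor T (fmor T a) \oc (fmor T (fmor T b) \oc x) = fmor T (fmor T c) \oc x).
Proof.
move=> e; have e1 : fmor T a \oc fmor T b = fmor T c by rewrite -fmorM e.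
have e2 : fmor T (fmor T a) \oc fmor T (fmor T b) = fmor T (fmor T c).
  by rewrite -fmorM e1.
by do !split; rewrite // => W x; rewrite cmpA ?e2 ?e1 ?e.
Qed.

Definition cone_rules M N (f : hom M N) :=
  (cmp_rules (cp_ci f), cmp_rules (cp_cj f), cmp_rules (cq_ci f),
   cmp_rules (cq_cj f), cmp_rules (dd_cone_ci f), cmp_rules (dd_cone_cj f)).

Lemma cmpAr (D : preaddCat) (X Y Z W : D) (h : hom Z W) (g : hom Y Z)
  (f : hom X Y) : h \oc g \oc f = h \oc (g \oc f).
Proof. exact/esym/cmpA. Qed.

(** Normalizes a sum of composites of maps of families: the composites are
    expanded, associated to the right, and those that meet the structure maps
    of a cone are evaluated.  What then remains of an identity holds in the
    free abelian group on composites. *)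
Definition normE := (@cone_rules, cmpAr, fmorM, fmorD, fmorN, fmor0, fmor1, cmpDl,
  cmpDr, cmpNm, cmpmN, cmp0m, cmpm0, cmp1m, cmpm1, @opprD, @opprK, @oppr0,
  @addr0, @add0r).

(** The contraction maps the summand [T M] of [T (cone (idm M))], which comes
    from the second summand of the cone, identically to the first summand. *)
Lemma cone_idm_null M : null_homotopic (idm (cone (idm M))).
Proof.
apply/nullP; exists (ci _ \oc fmor T (cq _)); rewrite fhE fmor1.
apply: cone_extT; rewrite !normE //.
by rewrite addrC subrK.
Qed.

(** The cone of [cone_in f] has the summands [T N], [T M] and [N].  The first
    and the last of these form a copy of [cone (idm N)], and contracting it
    leaves [Sigma M].  The inclusion [j] of [Sigma M] needs the component
    [- T f] to [T N] in order to be a morphism, and this is where the sign and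
    the suspension of [f] in the rotated triangle come from. *)
Lemma cone_cone_in M N (f : hom M N) :
  exists (q : hom (cone (cone_in d_even f)) (Sig M))
         (j : hom (Sig M) (cone (cone_in d_even f))),
    [/\ q \oc j = idm _, hcls (j \oc q) = hcls (idm _),
        q \oc cone_in d_even (cone_in d_even f) = cone_pr d_even f
      & cone_pr d_even (cone_in d_even f) \oc j = - fmor Sig f].
Proof.
set g := cone_in d_even f; have eg : fh_val g = cj f by [].
have [|q [qi qj]] := @cone_copair _ _ g (Sig M) (cone_pr d_even f) 0.
  by rewrite fh_cone_pr fh_cone_in !normE.
have [|j ej] := @fact_hom_of (Sig M) (cone g)
    (cj g \oc ci f - ci g \oc fmor T (fh_val f)).
  rewrite dd_Sigma !(normE, eg).
  by rewrite -(fmorM _ (dd N)) -dd_comm !normE [RHS]addrACA subrr add0r.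
exists q, j; split.
- apply: fact_hom_eq; rewrite !fhE ej.
  by rewrite !(normE, cmp_rules qi, cmp_rules qj, fh_cone_pr).
(* The homotopy is the contraction of the copy of [cone (idm N)]. *)
- apply/esym/hclsE; exists (ci g \oc fmor T (cq f \oc cq g)).
  rewrite !fhE ej; apply: cone_extT;
    rewrite [in RHS]cmpDl -(fmorM _ (_ \oc fh_val q)) -cmpA ?qi ?qj.
    by rewrite !(normE, eg).
  apply: cone_extT; rewrite !(normE, fh_cone_pr, eg).
    by rewrite subrK.
  by rewrite addrC subrK.
- exact: fact_hom_eq.
- apply: fact_hom_eq; rewrite !fhE ej fh_cone_pr fh_Sigma.
  by rewrite !normE.
Qed.

(** * The octahedron of mapping cones *)

Lemma addr_cancel (V : zmodType) (a b c : V) : a + (- b + (c + (- a + b))) = c.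
Proof.
by rewrite addrA [c + _]addrC addrA [- a + b]addrC -(opprB a b) subrr add0r.
Qed.

Lemma cone_extTT M N (f : hom M N) (X : Fam)
    (g g' : hom (T (T (cone f : Fam))) X) :
  g \oc fmor T (fmor T (ci f)) = g' \oc fmor T (fmor T (ci f)) ->
  g \oc fmor T (fmor T (cj f)) = g' \oc fmor T (fmor T (cj f)) -> g = g'.
Proof.
move=> ei ej; rewrite -[g]cmpm1 -[g']cmpm1 -!fmor1 -cone_idm !fmorD !fmorM.
by rewrite !cmpDr !cmpA ei ej.
Qed.

(** Here [u = (1, g)] and [v = (T f, 1)].  The cone of [u] has the summands
    [T^2 M], [T N], [T M] and [P]; the second and the last of these form
    [cone g], included by [j], while the other two form a copy of the
    contractible factorization [cone (idm (Sigma M))]. *)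
Lemma cone_octahedron M N P (f : hom M N) (g : hom N P) :
  exists (u : hom (cone f) (cone (g \oc f))) (v : hom (cone (g \oc f)) (cone g)),
  [/\ u \oc cone_in d_even f = cone_in d_even (g \oc f) \oc g,
      cone_pr d_even (g \oc f) \oc u = cone_pr d_even f,
      v \oc cone_in d_even (g \oc f) = cone_in d_even g &
      cone_pr d_even g \oc v = fmor Sig f \oc cone_pr d_even (g \oc f)] /\
  exists (q : hom (cone u) (cone g)) (j : hom (cone g) (cone u)),
    [/\ q \oc j = idm _, hcls (j \oc q) = hcls (idm _),
        q \oc cone_in d_even u = v
      & cone_pr d_even u \oc j
        = fmor Sig (cone_in d_even f) \oc cone_pr d_even g].
Proof.
have [|u [ui uj]] := cone_map_ex (f := f) (f' := g \oc f) (a := idm M)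
    (b := g) (s := 0).
  by rewrite !(normE, cmpm1).
have [|v [vi vj]] := cone_map_ex (f := g \oc f) (f' := g) (a := f)
    (b := idm P) (s := 0).
  by rewrite !normE.
rewrite !(fhE, normE) in ui uj vi vj.
have [|q [qi qj]] := cone_copair (f := u) (b := v) (t := ci g \oc fmor T (cq f)).
  rewrite !normE; apply: cone_extT.
    by rewrite !(normE, cmp_rules ui, cmp_rules vi).
  by rewrite !(normE, cmp_rules uj, cmp_rules vj) addrC subrK.
have [|j [ji jj]] := cone_copair (f := g)
    (b := cone_in d_even u \oc cone_in d_even (g \oc f))
    (t := ci u \oc fmor T (cj f)).
  rewrite !(fhE, fh_cone_in, normE) [RHS]addrC subrK.
  by rewrite -!fmorM uj.
exists u, v; split.
  split; apply: fact_hom_eq; rewrite ?fhE ?fh_Sigma ?fh_cone_pr ?fh_cone_in //.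
    by apply: cone_ext; rewrite !(normE, ui, uj).
  by apply: cone_ext; rewrite !(normE, vi, vj).
rewrite !(fhE, fh_cone_in) in jj.
exists q, j; split.
- apply: fact_hom_eq; apply: cone_ext; rewrite !(fhE, normE).
    by rewrite ji !(normE, cmp_rules qi).
  by rewrite jj !(normE, cmp_rules qj, vj).
(* The homotopy maps the summand [T M] of [cone u], in the source shifted by
   [T], identically to the summand [T^2 M]. *)
- apply/esym/hclsE.
  exists (ci u \oc fmor T (ci f \oc cp (g \oc f) \oc cq u)).
  apply: cone_extT;
    rewrite [in RHS]cmpDl fhE -(fmorM _ (_ \oc fh_val q)) -cmpA ?qi ?qj.
    apply: cone_extTT.
      by rewrite !(normE, cmp_rules ji, cmp_rules ui, cmp_rules uj).
    by rewrite !(normE, cmp_rules ji, cmp_rules ui, cmp_rules uj).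
  apply: cone_extT; rewrite !(normE, cmp_rules vi, cmp_rules vj, cmp_rules ji,
    cmp_rules jj, cmp_rules ui, cmp_rules uj).
    exact/esym/addr_cancel.
  by [].
- exact: fact_hom_eq.
- apply: fact_hom_eq; apply: cone_ext;
    rewrite !(fhE, fh_Sigma, fh_cone_in, fh_cone_pr, normE).
    by rewrite ji !normE.
  by rewrite jj !normE.
Qed.

(** * The suspension is an automorphism *)

Lemma twist_bij b : bijective (fob (twist C b)).
Proof. by case: b => /=; [exists id | exact: (susp_aut C).1]. Qed.

Lemma T_ob_inj : injective (fob T).
Proof.
move=> X Y /(congr1 (fun Z : Fam => Z (ord_pred _))) eXY.
apply: functional_extensionality_dep => i; rewrite -(ord_predK i).
exact: bij_inj (twist_bij _) _ _ (eXY i).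
Qed.

Lemma T_ob_surj (Y : Fam) : exists X : Fam, T X = Y.
Proof.
have tw b : {h : C -> C | cancel h (twist C b)}.
  by apply: cid; have [h _ hK] := twist_bij b; exists h.
exists (fun j => sval (tw ((ord_pred j).+1 < d)%N) (Y (ord_pred j))).
apply: functional_extensionality_dep => i.
rewrite -[LHS]/(twist C (i.+1 < d)%N
  (sval (tw ((ord_pred (ordS i)).+1 < d)%N) (Y (ord_pred (ordS i))))) ordSK.
by case: (tw _) => h hK; exact: hK.
Qed.

Lemma eqhom_inj (D : preaddCat) (X Y Z : D) (e : Y = Z) (f g : hom X Y) :
  eqhom e \oc f = eqhom e \oc g -> f = g.
Proof. by subst Z; rewrite eqhom1 !cmp1m. Qed.

(** The [i]-th component of the condition for [T f] is, along the canonical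
    identifications, the image under the faithful functor [twist] of the
    component of the condition for [f] at the cyclic successor of [i]; every
    index is such a successor. *)
Lemma factorizes_unshift (M : Fam) (f : hom M (T M)) :
  factorizes eta (fmor T f) -> factorizes eta f.
Proof.
move=> ff k; rewrite -(ord_predK k); move: (ord_pred k) => i.
have [e he] := pw_shift f d.
have ei : iter d T (T M) i = T (iter d T M) i by rewrite e.
have eqi : (eqhom e : fhom _ _) i = eqhom ei.
  by move: ei; clear he; destruct e => ei /=; rewrite eqhom1.
have hi : eqhom ei \oc pw (fmor T f) d i
    = fmor (twist C (i.+1 < d)%N) (pw f d (ordS i)).
  by rewrite -eqi; exact: (congr1 (fun k : fhom _ _ => k i) he).
have tw b (X : C) : twist C b (susp C X) = susp C (twist C b X) by case: b.
have tweta b (X : C) :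
    eqhom (tw b X) \oc fmor (twist C b) (eta X) = eta (twist C b X).
  case: b (tw b X) => /= e0; rewrite eqhom1 cmp1m //.
  by rewrite eta_susp.
apply: (fmor_inj (@twist_ff C (i.+1 < d)%N)); apply: (eqhom_inj (e := tw _ _)).
rewrite tweta -[RHS](ff i) fmorM -hi !cmpA; congr (_ \oc _).
have e1 : twist C (i.+1 < d)%N (iter d T M (ordS i))
    = twist C (i.+1 < d)%N (susp C (M (ordS i))) by rewrite iter_shift.
rewrite (eqhom_fmor _ e1).
have e0 : twist C (i.+1 < d)%N (iter d T M (ordS i)) = susp C (T M i).
  by rewrite e1 tw.
rewrite (eqhomM e1 (tw _ _) e0).
exact: eqhomM.
Qed.

Lemma factorization_eq (X : Fam) (f g : hom X (T X)) (ff : factorizes eta f)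
    (fg : factorizes eta g) :
  f = g -> Factorization ff = Factorization fg.
Proof. by move=> e; subst g; rewrite (Prop_irrelevance ff fg). Qed.

Lemma Sigma_ob_surj (N : FC) : exists M : FC, Sig M = N.
Proof.
case: N => Y g fg; have [X eX] := T_ob_surj Y; subst Y.
have [f ef] := T_surj (- g).
have ff : factorizes eta f.
  by apply: factorizes_unshift; rewrite ef; exact: factorizes_opp.
exists (Factorization ff); apply: factorization_eq.
by rewrite -[LHS]/(- fmor T f) ef opprK.
Qed.

(** Equal factorizations have equal structure maps; the statement avoids a
    transport along the equality of the underlying families. *)
Lemma eq_fa_mor M N (e : fa_ob M = fa_ob N) :
  M = N -> fmor T (eqhom e) \oc fa_mor M = fa_mor N \oc eqhom e.
Proof. by move=> eMN; subst N; rewrite eqhom1 fmor1 cmp1m cmpm1. Qed.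

Lemma Sigma_ob_inj : injective (fob Sig).
Proof.
case=> X f ff [Y g fg] e.
have eXY : X = Y by apply: T_ob_inj; exact: (congr1 (@fa_ob _ _ _) e).
subst Y; apply: factorization_eq; apply: T_inj; apply: oppr_inj.
have := eq_fa_mor (M := Sig (Factorization ff))
  (N := Sig (Factorization fg)) (erefl _) e.
by rewrite eqhom1 fmor1 cmp1m cmpm1.
Qed.

Lemma hcls_surj M N (u : @hom (HFactCat d eta) M N) :
  exists f : hom M N, hcls f = u.
Proof. by exists (repr u); exact: qclsK. Qed.

Lemma hcls_cmp M N P (g : hom N P) (f : hom M N) :
  hcls (g \oc f) = hcls g \oc hcls f.
Proof. exact/esym/qclsM. Qed.

Lemma hcls_opp M N (f : hom M N) : hcls (- f) = - hcls f.
Proof. exact: (fmorN (quotFun (null_ideal d eta))). Qed.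

Lemma hcls_Sigma M N (f : hom M N) :
  fmor (SigmaH eta d_even) (hcls f) = hcls (fmor Sig f).
Proof. exact: (quot_lift_morE (@Sigma_null _ _ eta d_even)). Qed.

Lemma Sigma_full M N (h : hom (Sig M) (Sig N)) :
  exists f : hom M N, fmor Sig f = h.
Proof.
have [k ek] := T_surj (fh_val h).
have [|f ef] := fact_hom_of (M := M) (N := N) (h := k).
  apply: T_inj; apply: oppr_inj.
  by rewrite !fmorM ek -cmpmN -cmpNm -!dd_Sigma; exact: (dd_comm h).
by exists f; apply: fact_hom_eq; rewrite fh_Sigma ef.
Qed.

Lemma SigmaH_automorphism : is_automorphism (SigmaH eta d_even).
Proof.
split; first by apply: inj_surj_bij; [exact: Sigma_ob_inj | exact: Sigma_ob_surj].
move=> M N; apply: inj_surj_bij => [u v|w].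
  have [f <-] := hcls_surj u; have [g <-] := hcls_surj v.
  rewrite !hcls_Sigma => /hclsE[s es]; apply/hclsE.
  have [t et] := T_surj s; exists (- t); apply: T_inj.
  rewrite -[LHS]/(fmor T (fh_val (fmor Sig f))) es !dd_Sigma fmorD; congr (_ + _).
  by rewrite -et cmpmN !fmorN cmpNm !fmorD !cmpNm !cmpmN !fmorN !fmorM.
have [h <-] := hcls_surj (M := Sig M) (N := Sig N) w.
by have [f <-] := Sigma_full h; exists (hcls f); exact: hcls_Sigma.
Qed.

(** * The triangulation *)

Local Notation D := (HFact_tri eta d_even).
Local Notation std := (standard_triangle d_even).

Lemma std_dist M N (f : hom M N) : td_dist D (std f).
Proof. by exists M, N, f; exact: tri_iso_refl. Qed.

Lemma HFact_iso (t t' : triangle (td_susp D)) :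
  tri_iso t t' -> td_dist D t -> td_dist D t'.
Proof.
by move=> tt' [M [N [f ft]]]; exists M, N, f; exact: tri_iso_trans tt'.
Qed.

(** The cone of an identity is contractible, hence a zero object up to
    homotopy. *)
Lemma HFact_id (X : D) :
  td_dist D (@Triangle D (td_susp D) X X zob (idm X) 0 0).
Proof.
exists X, X, (idm (X : FC)), (idm X), (idm X), 0.
have id0 : idm (cone (idm (X : FC)) : D) = 0.
  rewrite -[RHS](qcls0 (null_ideal d eta)); apply/(qclsP (null_ideal d eta)).
  by rewrite subr0; exact: cone_idm_null.
split.
  split; [exact: is_iso_id | exact: is_iso_id |].
  by exists 0; rewrite !cmp0m id0 zobP.
split; first exact: etrans (cmp1m _) (esym (cmpm1 _)).
  exact: etrans (cmp0m _ _) (esym (cmp0m _ _)).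
by rewrite [RHS]cmp0m -[LHS]cmpm1 [X in _ \oc X]id0 cmpm0.
Qed.

Lemma HFact_ext (X Y : D) (u : hom X Y) :
  exists (Z : D) (v : hom Y Z) (w : hom Z (td_susp D X)),
    td_dist D (Triangle u v w).
Proof.
have [f <-] := hcls_surj u.
by exists (cone f), (hcls (cone_in d_even f)), (hcls (cone_pr d_even f));
  exact: std_dist.
Qed.

Lemma HFact_rot (X Y Z : D) (u : hom X Y) (v : hom Y Z)
    (w : hom Z (td_susp D X)) :
  td_dist D (Triangle u v w) ->
  td_dist D (Triangle v w (- fmor (td_susp D) u)).
Proof.
move=> [M [N [f /tri_iso_rot ft]]]; apply: HFact_iso ft _.
have [q [j [qj jq qi pj]]] := cone_cone_in f.
exists _, _, (cone_in d_even f), (idm _), (idm _), (hcls q); split.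
  split; [exact: is_iso_id | exact: is_iso_id |].
  exists (hcls j); split; first by rewrite -hcls_cmp.
  by rewrite -hcls_cmp qj.
split; first exact: etrans (cmp1m _) (esym (cmpm1 _)).
  by rewrite -hcls_cmp qi cmpm1.
rewrite fmor1 cmp1m cmpNm -[LHS]cmpm1.
rewrite -[idm _]/(hcls (idm (cone (cone_in d_even f)))) -jq hcls_cmp cmpA.
by rewrite -[X in X \oc _]hcls_cmp pj hcls_opp -hcls_Sigma cmpNm.
Qed.

Lemma cone_functorial M N M' N' (f : hom M N) (f' : hom M' N') (a : hom M M')
    (b : hom N N') :
  hcls (b \oc f) = hcls (f' \oc a) ->
  exists c : hom (cone f) (cone f'),
    c \oc cone_in d_even f = cone_in d_even f' \oc b /\
    fmor Sig a \oc cone_pr d_even f = cone_pr d_even f' \oc c.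
Proof.
move=> /hclsE[s /(cone_map_ex)[c [ci_ cj_]]]; exists c; split.
  by apply: fact_hom_eq; rewrite !fhE fh_cone_in.
apply: fact_hom_eq; rewrite !fhE fh_Sigma !fh_cone_pr.
by apply: cone_ext; rewrite !(cmpAr, ci_, cj_, normE).
Qed.

(** Lift the commutative square to one that commutes up to homotopy. *)
Lemma std_extends M N M' N' (f : hom M N) (f' : hom M' N') :
  tri_extends (std f) (std f').
Proof.
move=> a b; have [a0 ea] := hcls_surj (M := M) (N := M') a.
have [b0 eb] := hcls_surj (M := N) (N := N') b.
subst a b => e; have [|c [c1 c2]] := @cone_functorial _ _ _ _ f f' a0 b0.
  by rewrite !hcls_cmp.
exists (hcls c); split; first by rewrite -[LHS]hcls_cmp c1 hcls_cmp.
by rewrite -[RHS]hcls_cmp -c2 hcls_cmp -hcls_Sigma.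
Qed.

Lemma HFact_mor (t t' : triangle (td_susp D)) :
  td_dist D t -> td_dist D t' -> tri_extends t t'.
Proof.
move=> [M [N [f ft]]] [M' [N' [f' ft']]].
exact: (tri_extends_iso ft ft' (@std_extends _ _ _ _ f f')).
Qed.

Lemma HFact_triangulated : triangulated D.
Proof.
have aut : is_automorphism (td_susp D) := SigmaH_automorphism.
split; first exact: aut.
- exact: HFact_iso.
- exact: HFact_id.
- exact: HFact_ext.
- move=> X Y Z u v w; split; first exact: HFact_rot.
  exact: (dist_rot_inv aut HFact_iso HFact_id HFact_ext HFact_rot HFact_mor).
- exact: HFact_mor.
- move=> X Y Z X' Y' Z' u v i i' j j' k k'.
  have [f <-] := hcls_surj u; have [g <-] := hcls_surj v.
  move=> du dv dvu.
  have std_dist' M N (h : hom M N) :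
      td_dist D (@Triangle D (SigmaH eta d_even) M N (cone h) (hcls h)
        (hcls (cone_in d_even h)) (hcls (cone_pr d_even h))) := std_dist h.
  have dgf := std_dist' _ _ (g \oc f); rewrite hcls_cmp in dgf.
  apply: (octahedron_transfer aut HFact_iso HFact_id HFact_rot HFact_mor
    (std_dist' _ _ f) (std_dist' _ _ g) dgf du dv dvu).
  have [x [y [[x1 x2 y1 y2] [q [c [qc cq qi pc]]]]]] := cone_octahedron f g.
  exists (hcls x), (hcls y); rewrite !hcls_Sigma -!hcls_cmp x1 x2 y1 y2.
  split=> //; apply: HFact_iso (std_dist x).
  exists (idm _), (idm _), (hcls q); split.
    split; [exact: is_iso_id | exact: is_iso_id |].
    by exists (hcls c); rewrite -!hcls_cmp qc cq.
  split; first exact: etrans (cmp1m _) (esym (cmpm1 _)).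
    by rewrite [RHS]cmpm1 -[LHS]hcls_cmp qi.
  rewrite fmor1 [LHS]cmp1m -[LHS]cmpm1 -[idm _]/(hcls (idm (cone x))) -cq.
  rewrite (hcls_cmp c q) [LHS]cmpA.
  by rewrite -(hcls_cmp (cone_pr d_even x) c) pc.
Qed.

(** * The exact structure of split sequences *)
Implicit Types W X Y Z : FC.

(** Splittings that commute with the curvature, rather than arbitrary ones of
    families, make contractible factorizations injective: see
    [contractible_injective]. *)
Definition split_conf X Y Z (i : hom X Y) (p : hom Y Z) : Prop :=
  exists (r : hom (Y : Fam) (X : Fam)) (s : hom (Z : Fam) (Y : Fam)),
    [/\ sqr_comm r, sqr_comm s, r \oc fh_val i = idm (X : Fam),
        fh_val p \oc s = idm (Z : Fam)
      & fh_val i \oc r + s \oc fh_val p = idm (Y : Fam)].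

(** Compatibility with the differentials can be tested after a split
    monomorphism. *)
Lemma split_mono_hom W X Y (i : hom X Y) (r : hom (Y : Fam) (X : Fam))
    (k : hom (W : Fam) (X : Fam)) (h : hom W Y) :
  r \oc fh_val i = idm (X : Fam) -> fh_val i \oc k = fh_val h ->
  exists k' : hom W X, fh_val k' = k.
Proof.
move=> ri ik; apply: fact_hom_of.
rewrite -[LHS]cmp1m -[RHS]cmp1m -fmor1 -ri fmorM -!cmpA; congr (_ \oc _).
by rewrite !cmpA -fmorM ik !dd_comm -cmpA ik.
Qed.

(** Compatibility with the differentials can be tested before a split
    epimorphism. *)
Lemma split_epi_hom W Y Z (p : hom Y Z) (s : hom (Z : Fam) (Y : Fam))
    (k : hom (Z : Fam) (W : Fam)) (h : hom Y W) :
  fh_val p \oc s = idm (Z : Fam) -> k \oc fh_val p = fh_val h ->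
  exists k' : hom Z W, fh_val k' = k.
Proof.
move=> ps kp; apply: fact_hom_of.
rewrite -[LHS]cmpm1 -[RHS]cmpm1 -ps !cmpA; congr (_ \oc _).
by rewrite -!cmpA kp -!dd_comm cmpA -fmorM kp.
Qed.

Lemma conf_kernel X Y Z (i : hom X Y) (p : hom Y Z) :
  split_conf i p -> is_kernel i p.
Proof.
move=> [r [s [cr cs ri ps e]]]; have [pi0 rs0] := split_orthogonal ri ps e.
split=> [|W h ph0]; first exact: fact_hom_eq.
have eh : fh_val i \oc (r \oc fh_val h) = fh_val h.
  rewrite -[RHS]cmp1m -e cmpDl -!cmpA -(fh_cmp p h) ph0 fh_zero cmpm0.
  by rewrite addr0.
have [k ek] := split_mono_hom ri eh; exists k; split.
  by apply: fact_hom_eq; rewrite fhE ek eh.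
move=> k' ik'; apply: fact_hom_eq.
by rewrite ek -ik' fhE cmpA ri cmp1m.
Qed.

Lemma conf_cokernel X Y Z (i : hom X Y) (p : hom Y Z) :
  split_conf i p -> is_cokernel i p.
Proof.
move=> [r [s [cr cs ri ps e]]]; have [pi0 rs0] := split_orthogonal ri ps e.
split=> [|W h hi0]; first exact: fact_hom_eq.
have eh : fh_val h \oc s \oc fh_val p = fh_val h.
  rewrite -[RHS]cmpm1 -e cmpDr !cmpA -(fh_cmp h i) hi0 fh_zero cmp0m.
  by rewrite add0r.
have [k ek] := split_epi_hom ps eh; exists k; split.
  by apply: fact_hom_eq; rewrite fhE ek eh.
move=> k' k'p; apply: fact_hom_eq.
by rewrite ek -k'p fhE -cmpA ps cmpm1.
Qed.

Lemma conf_iso X Y Z X' Y' Z' (i : hom X Y) (p : hom Y Z)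
      (i' : hom X' Y') (p' : hom Y' Z')
      (a : hom X X') (b : hom Y Y') (c : hom Z Z') :
    is_iso a -> is_iso b -> is_iso c ->
    b \oc i = i' \oc a -> c \oc p = p' \oc b -> split_conf i p -> split_conf i' p'.
Proof.
move=> [a' [a'a aa']] [b' [b'b bb']] [c' [c'c cc']] bi cp_.
move=> [r [s [cr cs ri ps e]]].
have ei : i' = b \oc i \oc a' by rewrite bi -cmpA aa' cmpm1.
have ep : p' = c \oc p \oc b' by rewrite cp_ -cmpA bb' cmpm1.
exists (fh_val a \oc r \oc fh_val b'), (fh_val b \oc s \oc fh_val c').
have fb : fh_val b' \oc fh_val b = idm (Y : Fam) by rewrite -fh_cmp b'b.
split.
- by do 2?[apply: sqr_comm_cmp => //]; exact: sqr_comm_hom.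
- by do 2?[apply: sqr_comm_cmp => //]; exact: sqr_comm_hom.
- rewrite ei !fhE -!cmpA (cmpA (fh_val b')) fb cmp1m (cmpA r) ri cmp1m.
  by rewrite -fh_cmp aa'.
- rewrite ep !fhE -!cmpA (cmpA (fh_val b')) fb cmp1m (cmpA (fh_val p)) ps cmp1m.
  by rewrite -fh_cmp cc'.
- rewrite ei ep !fhE -!cmpA (cmpA (fh_val a')) -(fh_cmp a' a) a'a.
  rewrite (cmpA (fh_val c')) -(fh_cmp c' c) c'c !fhE !cmp1m.
  rewrite -cmpDr !cmpA -cmpDl e cmp1m.
  by rewrite -fh_cmp bb'.
Qed.

Lemma conf_cone M N (f : hom M N) :
  split_conf (cone_in d_even f) (cone_pr d_even f).
Proof.
exists (cq f), (ci f); split; first exact: sqr_comm_cq.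
- exact: sqr_comm_ci.
- exact: cq_cj.
- exact: cp_ci.
- by rewrite addrC; exact: cone_idm.
Qed.

(** For a split sequence with retraction [r] and section [s], the map
    [(T r) d s] measures by how much [s] fails to be a morphism.  It is the
    suspension of a morphism [f], because [r] commutes with the curvature and
    [r s = 0], and the splitting identifies [Y] with [cone f]. *)
Lemma conf_coneP M X Y (i : hom X Y) (p : hom Y (Sig M)) : split_conf i p ->
  exists (f : hom M X) (b : hom (cone f) Y),
    [/\ is_iso b, b \oc cone_in d_even f = i & p \oc b = cone_pr d_even f].
Proof.
move=> [r [s [cr cs ri ps e]]]; have [pi0 rs0] := split_orthogonal ri ps e.
have [f0 ef0] := T_surj (fmor T r \oc dd Y \oc s : hom (T (M : Fam)) (T (X : Fam))).
have ds : dd Y \oc s = fmor T (fh_val i) \oc fmor T f0 - fmor T s \oc fmor T (dd M).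
  rewrite -cmpmN -dd_Sigma -[LHS]cmp1m -fmor1 -e fmorD !fmorM cmpDl ef0 -!cmpA.
  congr (_ + _ \oc _).
  by rewrite !cmpA dd_comm -cmpA ps cmpm1.
have [|f ef] := fact_hom_of (h := f0).
  have := congr1 (fun x => x \oc s) cr.
  rewrite sqrE -!cmpA rs0 cmpm0 ds cmpBr cmpBr !cmpA -(cmpA _ (fmor T (dd Y))).
  rewrite -(fmorM _ (dd Y)) -dd_comm fmorM !cmpA -!fmorM ri !fmor1 cmp1m.
  by rewrite -ef0 => /subr0_eq/T_inj.
have [|b [bi bj]] := cone_copair (f := f) (b := i) (t := s).
  by rewrite ds !fmorM ef addrC subrK.
have bK : fh_val b \oc (ci f \oc fh_val p + cj f \oc r) = fh_val (idm Y).
  by rewrite cmpDr !cmpA bi bj addrC e.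
have Kb : (ci f \oc fh_val p + cj f \oc r) \oc fh_val b = idm (cone f : Fam).
  apply: cone_ext; rewrite -cmpA ?bi ?bj cmpDl -!cmpA ?ps ?rs0 ?pi0 ?ri.
    by rewrite !normE.
  by rewrite !normE.
have [b' eb'] := split_mono_hom Kb bK.
exists f, b; split.
- by exists b'; split; apply: fact_hom_eq; rewrite fhE eb'.
- exact: fact_hom_eq.
- apply: fact_hom_eq; rewrite fhE fh_cone_pr; apply: cone_ext.
    by rewrite -cmpA bi ps cp_ci.
  by rewrite -cmpA bj pi0 cp_cj.
Qed.

Lemma conf_idm_l X : split_conf (idm X) (0 : hom X zob).
Proof.
exists (idm (X : Fam)), 0; split.
- exact: sqr_comm_hom (idm X).
- exact: sqr_comm0.
- by rewrite fhE cmp1m.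
- by rewrite cmpm0; exact/esym/zobP.
- by rewrite fhE cmp1m cmp0m addr0.
Qed.

Lemma conf_idm_r X : split_conf (0 : hom zob X) (idm X).
Proof.
exists 0, (idm (X : Fam)); split.
- exact: sqr_comm0.
- exact: sqr_comm_hom (idm X).
- by rewrite cmp0m; exact/esym/zobP.
- by rewrite fhE cmp1m.
- by rewrite fhE cmp1m cmp0m add0r.
Qed.

(** By [conf_coneP] the second inflation may be taken to be [cone_in f] for
    some [f : M -> Y]; a cokernel of the composite is then the cone of [p f]. *)
Lemma inflation_cmp X Y Z (i : hom X Y) (j : hom Y Z) :
  inflation split_conf i -> inflation split_conf j ->
  inflation split_conf (j \oc i).
Proof.
move=> [V [p ip]] [W [q jq]]; have [M eM] := Sigma_ob_surj W; subst W.
have [f [b [ib bj pb]]] := conf_coneP jq; have [b' [b'b bb']] := ib.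
have [|c [cci ccj]] := cone_map_ex (f := f) (f' := p \oc f) (a := idm M)
    (b := p) (s := 0); first by rewrite !normE.
rewrite !normE in cci ccj.
exists (cone (p \oc f)), (c \oc b').
apply: (@conf_iso _ _ _ _ _ _ (cone_in d_even f \oc i) c _ _ (idm X) b (idm _)).
- exact: is_iso_id.
- exact: ib.
- exact: is_iso_id.
- by rewrite cmpA bj cmpm1.
- by rewrite cmp1m -cmpA b'b cmpm1.
have [r [s [cr cs ri ps e]]] := ip.
exists (r \oc cq f), (ci f \oc cp (p \oc f) + cj f \oc s \oc cq (p \oc f)).
split.
- by apply: sqr_comm_cmp => //; exact: sqr_comm_cq.
- apply: sqr_comm_add.
    exact: sqr_comm_cmp (sqr_comm_ci f) (sqr_comm_cp _).
  apply: sqr_comm_cmp (sqr_comm_cq _).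
  by apply: sqr_comm_cmp => //; exact: sqr_comm_cj.
- by rewrite fhE fh_cone_in !normE.
- rewrite !(normE, cmp_rules cci, cmp_rules ccj, cmp_rules ps).
  exact: cone_idm.
- apply: cone_ext; rewrite !(fhE, fh_cone_in, cci, ccj, normE).
    by [].
  by rewrite -cmpDr e cmpm1.
Qed.

(** Dually, the first deflation may be taken to be [cone_pr f] for some
    [f : M -> V], and the kernel of the second one to be [Sigma k] with
    [k : K -> M]; the cone of [f k] is a kernel of the composite. *)
Lemma deflation_cmp X Y Z (p : hom X Y) (q : hom Y Z) :
  deflation split_conf p -> deflation split_conf q ->
  deflation split_conf (q \oc p).
Proof.
move=> [V [i ip]] [W [j jq]]; have [M eM] := Sigma_ob_surj Y; subst Y.
have [K eK] := Sigma_ob_surj W; subst W; have [k ek] := Sigma_full j.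
subst j; have [f [b [ib bi pb]]] := conf_coneP ip.
have [|c [cci ccj]] := cone_map_ex (f := f \oc k) (f' := f) (a := k)
    (b := idm _) (s := 0); first by rewrite !normE.
rewrite !normE in cci ccj.
exists (cone (f \oc k)), (b \oc c).
apply: (@conf_iso _ _ _ _ _ _ c (q \oc cone_pr d_even f) _ _ (idm _) b (idm _)).
- exact: is_iso_id.
- exact: ib.
- exact: is_iso_id.
- by rewrite cmpm1.
- by rewrite cmp1m -pb cmpA.
have [r [s [cr cs ri ps e]]] := jq; have [qk0 rs0] := split_orthogonal ri ps e.
rewrite fh_Sigma in ri e qk0.
exists (ci (f \oc k) \oc r \oc cp f + cj (f \oc k) \oc cq f), (ci f \oc s).
split.
- apply: sqr_comm_add.
    apply: sqr_comm_cmp (sqr_comm_cp _).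
    by apply: sqr_comm_cmp cr; exact: (sqr_comm_ci (f \oc k)).
  exact: sqr_comm_cmp (sqr_comm_cj _) (sqr_comm_cq f).
- by apply: sqr_comm_cmp cs; exact: (sqr_comm_ci f).
- apply: cone_ext; rewrite !(normE, cmp_rules cci, cmp_rules ccj, cmp_rules ri).
    by [].
  by [].
- by rewrite fhE fh_cone_pr !normE.
- apply: cone_ext; rewrite !(fhE, fh_cone_pr, normE, cmp_rules cci, cmp_rules ccj).
    by rewrite -cmpDr e cmpm1.
  by [].
Qed.

(** * The Frobenius category of factorizations *)

(** A compatible pair [(u, v)] is the same as a morphism [v] with a
    null-homotopy of [v h], namely the first component of [u]. *)
Lemma cone_pushout M X Y (g : hom M X) (f : hom X Y) (h : hom M Y) :
  f \oc g = h ->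
  exists c : hom (cone g) (cone h),
    is_pushout (cone_in d_even g) f c (cone_in d_even h)
    /\ cone_pr d_even h \oc c = cone_pr d_even g.
Proof.
move=> eh; subst h; have [|c [cci ccj]] := cone_map_ex (f := g)
    (f' := f \oc g) (a := idm M) (b := f) (s := 0); first by rewrite !normE.
rewrite !normE in cci ccj; exists c; split; last first.
  apply: fact_hom_eq; rewrite fhE !fh_cone_pr.
  by apply: cone_ext; rewrite !(normE, cci, ccj).
split=> [|W u v uv]; first exact: fact_hom_eq.
have uj : fh_val u \oc cj g = fh_val v \oc fh_val f.
  exact: (congr1 (@fh_val _ _ _ _ _) uv).
have [|k [ki kj]] := cone_copair (f := f \oc g) (b := v)
    (t := fh_val u \oc ci g).
  rewrite fh_cmp cmpA -uj [dd W \oc _]cmpA -dd_comm -(cmpA _ (dd (cone g))).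
  by rewrite dd_cone_ci !normE addrC subrK.
exists k; split; first split; try exact: fact_hom_eq.
  apply: fact_hom_eq; apply: cone_ext; rewrite fh_cmp -cmpA.
    by rewrite cci ki.
  by rewrite ccj cmpA kj uj.
move=> k' [k'c k'j]; apply: fact_hom_eq; apply: cone_ext.
  by rewrite ki -k'c fh_cmp -cmpA cci.
by rewrite kj -k'j.
Qed.

Lemma conf_pushout X Y X' (i : hom X Y) (f : hom X X') :
  inflation split_conf i ->
  exists (Y' : FC) (f' : hom Y Y') (i' : hom X' Y'),
    is_pushout i f f' i' /\ inflation split_conf i'.
Proof.
move=> [V [p ip]]; have [M eM] := Sigma_ob_surj V; subst V.
have [g [b [[b' [b'b bb']] bi _]]] := conf_coneP ip.
have [c [[cin push] _]] := cone_pushout (g := g) (erefl (f \oc g)).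
exists (cone (f \oc g)), (c \oc b'), (cone_in d_even (f \oc g)); split; last first.
  by exists (Sig M), (cone_pr d_even (f \oc g)); exact: conf_cone.
split; first by rewrite -bi -cmpA (cmpA b') b'b cmp1m.
move=> W u v uv; have [|k [[kc kj] uk]] := push W (u \oc b) v.
  by rewrite -cmpA bi.
exists k; split; first by rewrite cmpA kc -cmpA bb' cmpm1.
by move=> k' [k'c k'j]; apply: uk; rewrite -k'c -!cmpA b'b cmpm1.
Qed.

(** The dual of [cone_copair]. *)
Lemma cone_pair M N Q (f : hom M N) (a : hom Q (Sig M))
    (t : hom (Q : Fam) (N : Fam)) :
  fmor T t \oc dd Q = fmor T (fh_val f) \oc fh_val a + dd N \oc t ->
  exists h : hom Q (cone f), cp f \oc fh_val h = fh_val a /\ cq f \oc fh_val h = t.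
Proof.
move=> et; have [|h eh] := fact_hom_of (M := Q) (N := cone f)
    (h := ci f \oc fh_val a + cj f \oc t).
  rewrite !normE et (dd_comm a) dd_Sigma !normE.
  by rewrite addrA [- _ + _]addrC.
by exists h; rewrite eh !normE.
Qed.

Lemma conf_pullback Y Z Z' (p : hom Y Z) (f : hom Z' Z) :
  deflation split_conf p ->
  exists (Y' : FC) (f' : hom Y' Y) (p' : hom Y' Z'),
    is_pullback p f f' p' /\ deflation split_conf p'.
Proof.
move=> [X [i ip]]; have [M eM] := Sigma_ob_surj Z; subst Z.
have [M' eM'] := Sigma_ob_surj Z'; subst Z'.
have [k ek] := Sigma_full f; subst f.
have [g [b [[b' [b'b bb']] _ pb]]] := conf_coneP ip.
have [|c [cci ccj]] := cone_map_ex (f := g \oc k) (f' := g) (a := k)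
    (b := idm X) (s := 0); first by rewrite !normE.
rewrite !normE in cci ccj.
have cpr : cone_pr d_even g \oc c = fmor Sig k \oc cone_pr d_even (g \oc k).
  apply: fact_hom_eq; rewrite !fhE fh_Sigma !fh_cone_pr.
  by apply: cone_ext; rewrite !(normE, cci, ccj).
have cqc : cq g \oc fh_val c = cq (g \oc k).
  by apply: cone_ext; rewrite !(normE, cci, ccj).
exists (cone (g \oc k)), (b \oc c), (cone_pr d_even (g \oc k)); split; last first.
  by exists X, (cone_in d_even (g \oc k)); exact: conf_cone.
split; first by rewrite cmpA pb cpr.
move=> W u v uv.
have uk : cp g \oc fh_val (b' \oc u) = fmor T (fh_val k) \oc fh_val v.
  have e : cone_pr d_even g \oc (b' \oc u) = fmor Sig k \oc v.
    by rewrite -pb -uv -!cmpA (cmpA b) bb' cmp1m.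
  exact: (congr1 (@fh_val _ _ _ _ _) e).
have [|h [hp hq]] := cone_pair (f := g \oc k) (a := v)
    (t := cq g \oc fh_val (b' \oc u)).
  rewrite fmorM -cmpA dd_comm -[X in dd (cone g) \oc X]cmp1m -cone_idm.
  by rewrite cmpDl -!cmpA uk !normE.
have cpc : cp g \oc fh_val c = fmor T (fh_val k) \oc cp (g \oc k).
  exact: (congr1 (@fh_val _ _ _ _ _) cpr).
have chE : c \oc h = b' \oc u.
  apply: fact_hom_eq; rewrite fh_cmp.
  apply: cone_coext; first by rewrite cmpA cpc -cmpA hp uk.
  by rewrite cmpA cqc hq.
exists h; split; first split.
- by rewrite -cmpA chE cmpA bb' cmp1m.
- exact: fact_hom_eq.
move=> h' [ch' ph']; apply: fact_hom_eq; apply: cone_coext.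
  by rewrite hp -ph'.
have e : c \oc h' = b' \oc u by rewrite -ch' !cmpA b'b cmp1m.
by rewrite hq -e fh_cmp cmpA cqc.
Qed.

Lemma conf_exact : is_exact split_conf.
Proof.
split.
- exact: conf_kernel.
- exact: conf_cokernel.
- exact: conf_iso.
- by move=> X; exists zob, 0; exact: conf_idm_l.
- by move=> X; exists zob, 0; exact: conf_idm_r.
- exact: inflation_cmp.
- exact: deflation_cmp.
- exact: conf_pushout.
- exact: conf_pullback.
Qed.

(** A contraction [t] of [I] turns a retraction [r] of the inflation into the
    homotopy [t T(f r)], and the null-homotopic morphism that it defines
    extends [f]. *)
Lemma contractible_injective I :
  null_homotopic (idm I) -> is_injective split_conf I.
Proof.
move=> /nullP[t et] X Y i [Z [p [r [s [cr cs ri ps e]]]]] f.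
have [|g eg] := @homotopy_hom Y I (t \oc fmor T (fh_val f \oc r)).
  apply: (sqr_comm_cmp (M := Sig Y) (N := Sig I)).
    exact: (homotopy_sqr_comm et).
  apply/sqr_comm_T; exact: sqr_comm_cmp (sqr_comm_hom f) cr.
exists g; apply: fact_hom_eq; apply: T_inj; rewrite fhE fmorM eg.
have etr : t \oc fmor T (fh_val f \oc r) \oc fmor T (fh_val i)
    = t \oc fmor T (fh_val f) by rewrite -cmpA -fmorM -cmpA ri cmpm1.
rewrite cmpDl -fmorM -[X in fmor T X]cmpA -dd_comm [X in fmor T X]cmpA etr.
rewrite -(cmpA _ (t \oc _)) etr -[X in fmor T X]cmpA dd_comm cmpA fmorM cmpA.
by rewrite -cmpDl -et fhE fmor1 cmp1m.
Qed.

(** Dually, with the homotopy [s f t]. *)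
Lemma contractible_projective P :
  null_homotopic (idm P) -> is_projective split_conf P.
Proof.
move=> /nullP[t et] Y Z p [X [i [r [s [cr cs ri ps e]]]]] f.
have [|g eg] := @homotopy_hom P Y (s \oc fh_val f \oc t).
  apply: (sqr_comm_cmp (M := Sig P)) (homotopy_sqr_comm et).
  by apply: sqr_comm_cmp => //; exact: sqr_comm_hom.
exists g; apply: fact_hom_eq; apply: T_inj; rewrite fhE fmorM eg.
rewrite cmpDr -fmorM !cmpA ps cmp1m dd_comm -(cmpA (dd Z)) ps cmpm1 -dd_comm.
by rewrite -!cmpA fmorM -cmpDr -et fhE fmor1 cmpm1.
Qed.

(** The identity of [I] extends to the contractible object [cone (idm I)]. *)
Lemma injective_contractible I :
  is_injective split_conf I -> null_homotopic (idm I).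
Proof.
move=> injI; have [|g <-] := injI _ _ (cone_in d_even (idm I)) _ (idm I).
  by exists (Sig I), (cone_pr d_even (idm I)); exact: conf_cone.
rewrite -[cone_in _ _]cmp1m; apply/nullL/nullR; exact: cone_idm_null.
Qed.

Lemma projective_contractible P :
  is_projective split_conf P -> null_homotopic (idm P).
Proof.
have [M eM] := Sigma_ob_surj P; subst P.
move=> prP; have [|g <-] := prP _ _ (cone_pr d_even (idm M)) _ (idm (Sig M)).
  by exists M, (cone_in d_even (idm M)); exact: conf_cone.
rewrite -[g]cmp1m; apply/nullL/nullR; exact: cone_idm_null.
Qed.

Lemma enough_injectives X : exists (I : FC) (i : hom X I),
  is_injective split_conf I /\ inflation split_conf i.
Proof.
exists (cone (idm X)), (cone_in d_even (idm X)); split.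
  exact/contractible_injective/cone_idm_null.
by exists (Sig X), (cone_pr d_even (idm X)); exact: conf_cone.
Qed.

Lemma enough_projectives X : exists (P : FC) (p : hom P X),
  is_projective split_conf P /\ deflation split_conf p.
Proof.
have [M eM] := Sigma_ob_surj X; subst X.
exists (cone (idm M)), (cone_pr d_even (idm M)); split.
  exact/contractible_projective/cone_idm_null.
by exists M, (cone_in d_even (idm M)); exact: conf_cone.
Qed.

Lemma projective_injective P :
  is_projective split_conf P <-> is_injective split_conf P.
Proof.
split=> [/projective_contractible|/injective_contractible].
  exact: contractible_injective.
exact: contractible_projective.
Qed.

Definition FactFrob : frobeniusCat :=
  FrobeniusCat conf_exact enough_injectives enough_projectives
    projective_injective.

Definition FactHulls : hulls FactFrob :=
  @Hulls FactFrob (fun X : FC => cone (idm X)) (fob Sig)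
    (fun X : FC => cone_in d_even (idm X))
    (fun X : FC => cone_pr d_even (idm X))
    (fun X : FC => conf_cone (idm X))
    (fun X : FC => contractible_injective (cone_idm_null X)).

(** A null-homotopic morphism on [M] extends to [cone (idm M)]; conversely the
    identity of a projective object is null-homotopic. *)
Lemma stably_zeroP M N (f : hom M N) :
  @stably_zero FactFrob M N f <-> null_homotopic f.
Proof.
split=> [[P [a [b [prP ->]]]]|].
  rewrite -[a]cmp1m; apply/nullL/nullR; exact: projective_contractible prP.
move=> /nullP[s es]; have [|h [hi hj]] := cone_copair (f := idm M)
    (b := f) (t := s).
  by rewrite fhE cmpm1.
exists (cone (idm M)), (cone_in d_even (idm M)), h; split.
  exact/contractible_projective/cone_idm_null.
exact: fact_hom_eq.
Qed.

(** * Comparison with the stable category *)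

Local Notation E := FactFrob.
Local Notation St := (stable_tri FactHulls).

Fact id_null_stable M N (f : hom M N) :
  idl (null_ideal d eta) f -> idl (stable_ideal E) (fmor (idFun FC) f).
Proof. by move=> nf; apply/(stably_zeroP). Qed.

Definition HFact_stable : addFun D St := quot_lift id_null_stable.

Lemma HFact_stableE M N (f : hom M N) :
  fmor HFact_stable (hcls f) = qcls (stable_ideal E) f.
Proof. exact: (quot_lift_morE id_null_stable f). Qed.

(** The morphism that [f] induces on the hulls, up to the choice of the
    extension, is the one on the cones of identities. *)
Lemma stable_susp_Sigma M N (f : hom M N) :
  fmor (td_susp St) (qcls (stable_ideal E) f)
  = qcls (stable_ideal E) (fmor Sig f).
Proof.
apply: (stable_susp_morE (H := FactHulls)).
have [|m [m1 m2]] := @cone_functorial _ _ _ _ (idm M) (idm N) f f.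
  by rewrite cmp1m cmpm1.
by exists m.
Qed.

Lemma HFact_stable_ff : fully_faithful HFact_stable.
Proof.
move=> M N; apply: inj_surj_bij => [u v|w].
  have [f <-] := hcls_surj (M := M) (N := N) u.
  have [g <-] := hcls_surj (M := M) (N := N) v.
  rewrite !HFact_stableE => /(qclsP (stable_ideal E))/(stably_zeroP) fg.
  exact/(qclsP (null_ideal d eta)).
exists (hcls (repr w : @hom FC M N)); rewrite HFact_stableE.
exact: qclsK.
Qed.

Definition Sigma_stable_iso (X : D) :
  hom (HFact_stable (td_susp D X)) (td_susp St (HFact_stable X)) :=
  @idm (stableCat E) (Sig X).

Lemma Sigma_stable_iso_nat (X Y : D) (f : hom X Y) :
  fmor (td_susp St) (fmor HFact_stable f) \oc Sigma_stable_iso X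
  = Sigma_stable_iso Y \oc fmor HFact_stable (fmor (td_susp D) f).
Proof.
have [g <-] := hcls_surj (M := X) (N := Y) f.
rewrite hcls_Sigma !HFact_stableE stable_susp_Sigma.
exact: etrans (cmpm1 _) (esym (cmp1m _)).
Qed.

Lemma cone_pr_in M N (f : hom M N) : cone_pr d_even f \oc cone_in d_even f = 0.
Proof. by apply: fact_hom_eq; exact: cp_cj. Qed.

Lemma std_stable M N (f : hom M N) :
  stable_standard (tri_image Sigma_stable_iso (std f)).
Proof.
have [k [push hk]] := cone_pushout (cmpm1 f).
have -> : tri_image Sigma_stable_iso (std f)
    = @Triangle (stableCat E) (td_susp St)
   M N (cone f) (qcls (stable_ideal E) f)
   (qcls (stable_ideal E) (cone_in d_even f))
   (qcls (stable_ideal E) (cone_pr d_even f)).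
  rewrite /tri_image; congr Triangle.
  - exact: HFact_stableE.
  - exact: HFact_stableE.
  - by rewrite [LHS]cmp1m; exact: HFact_stableE.
apply: (@StableStandard E FactHulls M N (cone f) f k) => //.
exact: cone_pr_in.
Qed.

Lemma HFact_algebraic : algebraic D.
Proof.
exists E, FactHulls, HFact_stable, Sigma_stable_iso; split.
- exact: HFact_stable_ff.
- by move=> Y; exists Y, (@idm (stableCat E) Y); exact: is_iso_id.
- by move=> X; exact: is_iso_id.
- exact: Sigma_stable_iso_nat.
- move=> t [M [N [f ft]]]; exists (tri_image Sigma_stable_iso (std f)).
    exact: std_stable.
  exact: tri_image_iso Sigma_stable_iso_nat ft.
Qed.

End FactTheory.

Local Close Scope ring_scope.

Theorem theorem2p4 (C : suspCat) (eta : suspNat C) (d : nat)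
    (d_ge2 : 2 <= d) (d_even : ~~ odd d) :
  triangulated (HFact_tri eta d_even) /\ algebraic (HFact_tri eta d_even).
Proof.
by split; [exact: HFact_triangulated | exact: HFact_algebraic].
Qed.
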